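(* Let $q$ be a real number with $0<|q|<1$ and let $(\Omega,d)$ be Woronowicz's three-dimensional $*$-differential calculus over the Hopf $*$-algebra $\mathcal{A}_q$ of $SU_q(2)$, with the left-invariant inner product on $\Omega$ for which $1,\ \eta_1,\eta_2,\eta_3,\ q^{-7}\eta_1\eta_2,\ q\,\eta_2\eta_3,\ -q^{-6}\eta_3\eta_1,\ \eta_1\eta_2\eta_3$ is an orthonormal basis of $\Omega^{\mathrm{inv}}$, and let $\nabla=(d+d^* )^2$ be the Laplacian. For $M=2m+1\in\{1,2,3,\dots\}$, $p\in\{-m,\dots,m\}$ and $k\in\{-m-1,-m,\dots,m+1\}$ let $\mathcal{E}_1(M,p,k)\subseteq\Omega_1$ be the linear span of $W^M_{p,k+1}\eta_1$, $W^M_{pk}\eta_2$ and $W^M_{p,k-1}\eta_3$ (with $W^M_{p,j}=0$ for $|j|>m$); these spaces are invariant under $\nabla$. Then there exists a positive constant $C(q)$, depending only on $q$ and not on $M$, $p$ and $k$, such that $\nabla\ge C(q)\max(q^{-8k},1)$ on $\mathcal{E}_1(M,p,k)$.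
   Context: $\mathcal{A}_q$ is the universal unital $*$-algebra generated by $\alpha,\gamma$ with $\alpha^*\alpha+\gamma^*\gamma=1$, $\alpha\alpha^*+q^2\gamma\gamma^*=1$, $\gamma\gamma^*=\gamma^*\gamma$, $\alpha\gamma=q\gamma\alpha$, $\alpha\gamma^*=q\gamma^*\alpha$, with $\Delta(\alpha)=\alpha\otimes\alpha-q\gamma^*\otimes\gamma$, $\Delta(\gamma)=\gamma\otimes\alpha+\alpha^*\otimes\gamma$; $h$ is its (positive, faithful) Haar integral. For a linear functional $\chi$ on $\mathcal{A}_q$, $\chi*a=(\mathrm{id}\otimes\chi)\Delta(a)$. The calculus: $\Omega=\bigoplus_{k=0}^3\Omega_k$ is a graded algebra with $\Omega_0=\mathcal{A}_q$, generated by $\mathcal{A}_q$ and $1$-forms $\eta_1,\eta_2,\eta_3$; as left $\mathcal{A}_q$-modules, $\Omega_1,\Omega_2,\Omega_3$ are free with bases $\{\eta_1,\eta_2,\eta_3\}$, $\{\eta_1\eta_2,\eta_2\eta_3,\eta_3\eta_1\}$, $\{\eta_1\eta_2\eta_3\}$. Relations: $\eta_r^2=0$, $\eta_2\eta_1=-q^4\eta_1\eta_2$, $\eta_3\eta_2=-q^4\eta_2\eta_3$, $\eta_1\eta_3=-q^{-2}\eta_3\eta_1$; $\eta_r\alpha=q^{-\varepsilon_r}\alpha\eta_r$, $\eta_r\gamma=q^{-\varepsilon_r}\gamma\eta_r$, $\eta_r\alpha^*=q^{\varepsilon_r}\alpha^*\eta_r$, $\eta_r\gamma^*=q^{\varepsilon_r}\gamma^*\eta_r$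 with $\varepsilon_1=\varepsilon_3=1$, $\varepsilon_2=2$. The graded involution satisfies $(\omega_1\omega_2)^*=(-1)^{kl}\omega_2^*\omega_1^*$ for $\omega_1\in\Omega_k$, $\omega_2\in\Omega_l$, and $\eta_1^*=q\eta_3$, $\eta_2^*=-\eta_2$, $\eta_3^*=q^{-1}\eta_1$. The differential $d$ is the degree-one graded derivation ($d(\omega'\omega)=d(\omega')\omega+(-1)^k\omega'd\omega$ for $\omega'\in\Omega_k$) with $d^2=0$, $d(\omega^* )=(d\omega)^*$ and $$d\alpha=\alpha\eta_2-q^2\gamma^*\eta_3,\quad d\gamma=\gamma\eta_2+q\alpha^*\eta_3,\quad d\alpha^*=-q^2\alpha^*\eta_2-\gamma\eta_1,\quad d\gamma^*=-q^2\gamma^*\eta_2+q^{-1}\alpha\eta_1,$$ $$d\eta_1=q^2(1+q^2)\eta_1\eta_2,\quad d\eta_2=q\eta_1\eta_3,\quad d\eta_3=q^2(1+q^2)\eta_2\eta_3.$$ The space $\Omega^{\mathrm{inv}}$ of left-invariant forms is the span of $1,\eta_1,\eta_2,\eta_3,\eta_1\eta_2,\eta_2\eta_3,\eta_3\eta_1,\eta_1\eta_2\eta_3$, and $\Omega\cong\mathcal{A}_q\otimes\Omega^{\mathrm{inv}}$ via $a\otimes\omega\mapsto a\omega$. An inner product on $\Omega$ (linear in the first variable) is left-invariant if $(a\omega\mid b\eta)=h(b^*a)(\omega\mid\eta)$ for $a,b\in\mathcal{A}_q$, $\omega,\eta\in\Omega^{\mathrm{inv}}$. The operator $d$ has an adjoint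 $d^*$ on $\Omega$ for this inner product. The inequality $\nabla\ge t$ on an invariant subspace $\mathcal{E}$ means $(\nabla\omega\mid\omega)\ge t(\omega\mid\omega)$ for all $\omega\in\mathcal{E}$. There are unique linear functionals $\chi_1,\chi_2,\chi_3$ on $\mathcal{A}_q$ with $da=\sum_{r=1}^3(\chi_r*a)\eta_r$ for $a\in\mathcal{A}_q$. Put $\lambda_k=\frac{q^2}{1-q^2}(q^{-4k}-1)$ and, given $m$, $c_k=\frac{q}{1-q^2}[(q^{-2k}-q^{2m})(q^{-2m}-q^{-2(k-1)})]^{1/2}$ for $-m\le k\le m$, $c_{m+1}=0$. For $M=2m+1\ge1$, $W^M=(W^M_{pk})_{p,k=-m,\dots,m}$ is the $M$-dimensional irreducible (invertible, not necessarily unitary) representation of $SU_q(2)$ constructed by Woronowicz, with matrix elements taken in a basis adapted to the infinitesimal generators: $\Delta(W^M_{pk})=\sum_iW^M_{pi}\otimes W^M_{ik}$ and $$\chi_1(W^M_{ik})=-c_{k+1}\delta_{i,k+1},\qquad\chi_2(W^M_{ik})=\lambda_k\delta_{ik},\qquad\chi_3(W^M_{ik})=q\,c_k\,\delta_{i,k-1}.$$ The elements $W^M_{pk}$ form a linear basis of $\mathcal{A}_q$. All indices $p,k$ run in integer steps (integers or half-integers according to $m$). *)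

(* Defs.v *)
From HB Require Import structures.
From mathcomp Require Import all_boot all_order all_algebra.
From mathcomp Require Import reals complex.

Set Implicit Arguments.
Unset Strict Implicit.
Unset Printing Implicit Defensive.

Import Order.TTheory GRing.Theory Num.Theory.
Local Open Scope ring_scope.

(* The scalars are the complex numbers R[i] over a model R of the reals. *)

Section StarAlgebras.
Variable R : realType.

Record is_star (A : algType R[i]) (s : A -> A) : Prop := IsStar {
  is_starD : forall a b, s (a + b) = s a + s b;
  is_starZ : forall (c : R[i]) a, s (c *: a) = c^* *: s a;
  is_starM : forall a b, s (a * b) = s b * s a;
  is_starK : forall a, s (s a) = a }.

Record starAlg := StarAlg {
  starAlg_sort :> algType R[i];
  star : starAlg_sort -> starAlg_sort;
  starP : is_star star }.

Definition bilin (U V : lmodType R[i]) (f : U -> U -> V) : Prop :=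
  (forall u, linear (f u)) /\ (forall v, linear (fun u => f u v)).

(* The algebraic tensor product of the *-algebra A with itself: a *-algebra   *)
(* with a bilinear map ten from A x A, spanned by the pure tensors, through   *)
(* which every bilinear map f factors; tlift f is the factorization (it is    *)
(* unspecified when f is not bilinear).                                       *)
Record tensorSquare (A : starAlg) := TensorSquare {
  tens :> starAlg;
  ten : A -> A -> tens;
  tlift : forall V : lmodType R[i], (A -> A -> V) -> tens -> V;
  ten_bilin : bilin ten;
  ten_span : forall t : tens,
    exists n (a b : 'I_n -> A), t = \sum_(i < n) ten (a i) (b i);
  tlift_linear : forall (V : lmodType R[i]) (f : A -> A -> V),
    bilin f -> linear (tlift f);
  tlift_ten : forall (V : lmodType R[i]) (f : A -> A -> V),
    bilin f -> forall a b, tlift f (ten a b) = f a b;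
  ten1 : ten 1 1 = 1;
  tenM : forall a b a' b', ten a b * ten a' b' = ten (a * a') (b * b');
  ten_star : forall a b, star (ten a b) = ten (star a) (star b) }.

(* (id (x) f) and (f (x) id) *)
Definition slice_r (A : starAlg) (T : tensorSquare A) (f : A -> R[i]) : T -> A :=
  tlift (fun a b : A => f b *: a).
Definition slice_l (A : starAlg) (T : tensorSquare A) (f : A -> R[i]) : T -> A :=
  tlift (fun a b : A => f a *: b).

End StarAlgebras.

(* Integer powers of the real number q, seen as complex numbers. *)
Definition qpow (R : realType) (q : R) (n : int) : R[i] := real_complex R (q ^ n).

Section QuantumGroup.
Variables (R : realType) (q : R).

Local Notation Q := (qpow q).

Record SUq2_relations (A : starAlg R) (al ga : A) : Prop := SUq2Relations {
  SUq2_rel1 : star al * al + star ga * ga = 1;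
  SUq2_rel2 : al * star al + Q 2 *: (ga * star ga) = 1;
  SUq2_rel3 : ga * star ga = star ga * ga;
  SUq2_rel4 : al * ga = Q 1 *: (ga * al);
  SUq2_rel5 : al * star ga = Q 1 *: (star ga * al) }.

(* The Hopf *-algebra A_q of SU_q(2): the universal unital *-algebra on alpha *)
(* and gamma, with its comultiplication and its Haar integral.                *)
Record SUq2 := MkSUq2 {
  Aq :> starAlg R;
  alpha : Aq;
  gamma : Aq;
  Aq_rel : SUq2_relations alpha gamma;
  Aq_gen : forall P : Aq -> Prop,
    P 1 -> P alpha -> P gamma ->
    (forall a b, P a -> P b -> P (a + b)) ->
    (forall (c : R[i]) a, P a -> P (c *: a)) ->
    (forall a b, P a -> P b -> P (a * b)) ->
    (forall a, P a -> P (star a)) ->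
    forall a, P a;
  Aq_univ : forall (B : starAlg R) (x y : B), SUq2_relations x y ->
    exists f : {lrmorphism Aq -> B},
      [/\ forall a, f (star a) = star (f a), f alpha = x & f gamma = y];
  AqT : tensorSquare Aq;
  Delta : {lrmorphism Aq -> AqT};
  Delta_star : forall a, Delta (star a) = star (Delta a);
  Delta_alpha :
    Delta alpha = ten AqT alpha alpha - Q 1 *: ten AqT (star gamma) gamma;
  Delta_gamma :
    Delta gamma = ten AqT gamma alpha + ten AqT (star alpha) gamma;
  haar : {scalar Aq};
  haar1 : haar 1 = 1;
  haar_inv_r : forall a, slice_r haar (Delta a) = haar a *: 1;
  haar_inv_l : forall a, slice_l haar (Delta a) = haar a *: 1;
  haar_ge0 : forall a, 0 <= haar (star a * a);
  haar_faithful : forall a, haar (star a * a) = 0 -> a = 0 }.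

(* chi * a = (id (x) chi) (Delta a) *)
Definition conv (G : SUq2) (chi : {scalar G}) (a : G) : G :=
  slice_r chi (Delta G a).

(* The list 1, eta1, eta2, eta3, eta1 eta2, eta2 eta3, eta3 eta1,             *)
(* eta1 eta2 eta3, and the degrees of its entries.                            *)
Definition inv_basis (Om : algType R[i]) (e1 e2 e3 : Om) (i : 'I_8) : Om :=
  [:: 1; e1; e2; e3; e1 * e2; e2 * e3; e3 * e1; e1 * e2 * e3]`_i.
Definition inv_deg (i : 'I_8) : nat := nth 0%N [:: 0; 1; 1; 1; 2; 2; 2; 3]%N i.

(* omega lies in the left A_q-module spanned by the basis forms of degree k;  *)
(* for k > 3 this means omega = 0.                                            *)
Definition homogeneous (G : SUq2) (Om : algType R[i]) (j : G -> Om)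
    (e1 e2 e3 : Om) (k : nat) (w : Om) : Prop :=
  exists a : {ffun 'I_8 -> G},
    w = \sum_(i | inv_deg i == k) j (a i) * inv_basis e1 e2 e3 i.

Definition eta_commutes (G : SUq2) (Om : algType R[i]) (j : G -> Om)
    (e : Om) (n : int) : Prop :=
  [/\ e * j (alpha G) = Q (- n) *: (j (alpha G) * e),
      e * j (gamma G) = Q (- n) *: (j (gamma G) * e),
      e * j (star (alpha G)) = Q n *: (j (star (alpha G)) * e) &
      e * j (star (gamma G)) = Q n *: (j (star (gamma G)) * e)].

(* Woronowicz's three-dimensional *-differential calculus over A_q; inA is    *)
(* the embedding of A_q = Omega_0 into Omega.                                 *)
Record calculus (G : SUq2) := Calculus {
  Omega :> algType R[i];
  inA : {lrmorphism G -> Omega};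
  eta1 : Omega;
  eta2 : Omega;
  eta3 : Omega;
  Omega_free : forall w : Omega, exists! a : {ffun 'I_8 -> G},
    w = \sum_i inA (a i) * inv_basis eta1 eta2 eta3 i;
  eta11 : eta1 * eta1 = 0;
  eta22 : eta2 * eta2 = 0;
  eta33 : eta3 * eta3 = 0;
  eta21 : eta2 * eta1 = - Q 4 *: (eta1 * eta2);
  eta32 : eta3 * eta2 = - Q 4 *: (eta2 * eta3);
  eta13 : eta1 * eta3 = - Q (- 2) *: (eta3 * eta1);
  eta1A : eta_commutes inA eta1 1;
  eta2A : eta_commutes inA eta2 2;
  eta3A : eta_commutes inA eta3 1;
  ostar : Omega -> Omega;
  ostarD : forall w w', ostar (w + w') = ostar w + ostar w';
  ostarZ : forall (c : R[i]) w, ostar (c *: w) = c^* *: ostar w;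
  ostarK : forall w, ostar (ostar w) = w;
  ostarM : forall k l w w',
    homogeneous inA eta1 eta2 eta3 k w -> homogeneous inA eta1 eta2 eta3 l w' ->
    ostar (w * w') = (-1) ^+ (k * l) * (ostar w' * ostar w);
  ostarA : forall a, ostar (inA a) = inA (star a);
  ostar_eta1 : ostar eta1 = Q 1 *: eta3;
  ostar_eta2 : ostar eta2 = - eta2;
  ostar_eta3 : ostar eta3 = Q (- 1) *: eta1;
  diff : {linear Omega -> Omega};
  diff_deg : forall k w, homogeneous inA eta1 eta2 eta3 k w ->
    homogeneous inA eta1 eta2 eta3 k.+1 (diff w);
  diffM : forall k w' w, homogeneous inA eta1 eta2 eta3 k w' ->
    diff (w' * w) = diff w' * w + (-1) ^+ k * (w' * diff w);
  diff_diff : forall w, diff (diff w) = 0;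
  diff_star : forall w, diff (ostar w) = ostar (diff w);
  diff_alpha : diff (inA (alpha G)) =
    inA (alpha G) * eta2 - Q 2 *: (inA (star (gamma G)) * eta3);
  diff_gamma : diff (inA (gamma G)) =
    inA (gamma G) * eta2 + Q 1 *: (inA (star (alpha G)) * eta3);
  diff_star_alpha : diff (inA (star (alpha G))) =
    - Q 2 *: (inA (star (alpha G)) * eta2) - inA (gamma G) * eta1;
  diff_star_gamma : diff (inA (star (gamma G))) =
    - Q 2 *: (inA (star (gamma G)) * eta2) + Q (- 1) *: (inA (alpha G) * eta1);
  diff_eta1 : diff eta1 = (Q 2 * (1 + Q 2)) *: (eta1 * eta2);
  diff_eta2 : diff eta2 = Q 1 *: (eta1 * eta3);
  diff_eta3 : diff eta3 = (Q 2 * (1 + Q 2)) *: (eta2 * eta3) }.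

Definition left_invariant_form (G : SUq2) (X : calculus G) (w : X) : Prop :=
  exists c : {ffun 'I_8 -> R[i]},
    w = \sum_i c i *: inv_basis (eta1 X) (eta2 X) (eta3 X) i.

Record inner_product (V : lmodType R[i]) (ip : V -> V -> R[i]) : Prop :=
  InnerProduct {
    ip_linear : forall (c : R[i]) x y z,
      ip (c *: x + y) z = c * ip x z + ip y z;
    ip_conj : forall x y, ip y x = (ip x y)^*;
    ip_gt0 : forall x, x != 0 -> 0 < ip x x }.

Definition left_invariant_ip (G : SUq2) (X : calculus G)
    (ip : X -> X -> R[i]) : Prop :=
  forall (a b : G) (w w' : X),
    left_invariant_form w -> left_invariant_form w' ->
    ip (inA X a * w) (inA X b * w') = haar G (star b * a) * ip w w'.

(* 1, eta1, eta2, eta3, q^-7 eta1 eta2, q eta2 eta3, - q^-6 eta3 eta1,        *)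
(* eta1 eta2 eta3                                                             *)
Definition onb (G : SUq2) (X : calculus G) (i : 'I_8) : X :=
  [:: 1; 1; 1; 1; Q (- 7); Q 1; - Q (- 6); 1]`_i
    *: inv_basis (eta1 X) (eta2 X) (eta3 X) i.

Definition orthonormal_onb (G : SUq2) (X : calculus G)
    (ip : X -> X -> R[i]) : Prop :=
  forall i j : 'I_8, ip (onb X i) (onb X j) = (i == j)%:R.

Definition is_adjoint (V : lmodType R[i]) (ip : V -> V -> R[i])
    (D Dstar : V -> V) : Prop :=
  forall x y, ip (D x) y = ip x (Dstar y).

Definition laplacian (G : SUq2) (X : calculus G) (dstar : X -> X) (w : X) : X :=
  let D (v : X) := diff X v + dstar v in D (D w).

Definition is_chi (G : SUq2) (X : calculus G)
    (chi1 chi2 chi3 : {scalar G}) : Prop :=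
  forall a : G, diff X (inA X a) =
    inA X (conv chi1 a) * eta1 X + inA X (conv chi2 a) * eta2 X
    + inA X (conv chi3 a) * eta3 X.

(* The indices p, k in {-m, ..., m} are encoded by their positions            *)
(* p + m, k + m in {0, ..., M - 1}, M = 2 m + 1.  To stay within the integers *)
(* when m is a half-integer, the formulas below use twice M j = 2 k, where    *)
(* j = k + m may be any integer.                                              *)
Definition twice (M : nat) (j : int) : int := 2 * j - (M%:Z - 1).

(* lambda_k and c_k as functions of K = 2 k.  For k = m + 1 the formula for   *)
(* c_k gives c_(m+1) = 0 (the second factor vanishes).                        *)
Definition lambda (K : int) : R := q ^ 2 / (1 - q ^ 2) * (q ^ (- 2 * K) - 1).
Definition cc (M : nat) (K : int) : R :=
  q / (1 - q ^ 2) *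
  Num.sqrt ((q ^ (- K) - q ^ (M%:Z - 1)) * (q ^ (- (M%:Z - 1)) - q ^ (- (K - 2)))).

(* No subspace of C^M (the row space of U) other than 0 and C^M is invariant  *)
(* under the corepresentation e_k |-> sum_i e_i (x) W_ik.                     *)
Definition corep_irreducible (G : SUq2) (M : nat) (W : 'M[G]_M) : Prop :=
  forall U : 'M[R[i]]_M,
    (forall f : {scalar G}, stablemx U (map_mx f W)^T) ->
    U = 0 \/ row_full U.

(* W 0 is the empty matrix and carries no information; row i and column k of *)
(* W M are positions, with weights i - m and k - m.                           *)
Record woronowicz_reps (G : SUq2) (chi1 chi2 chi3 : {scalar G})
    (W : forall M : nat, 'M[G]_M) : Prop := WoronowiczReps {
  W_Delta : forall (M : nat) (p k : 'I_M),
    Delta G (W M p k) = \sum_i ten (AqT G) (W M p i) (W M i k);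
  W_invertible : forall M : nat,
    exists V : 'M[G]_M, W M *m V = 1%:M /\ V *m W M = 1%:M;
  W_irreducible : forall M : nat, (0 < M)%N -> corep_irreducible (W M);
  W_chi1 : forall (M : nat) (i k : 'I_M), chi1 (W M i k) =
    if i == k.+1 :> nat
    then real_complex R (- cc M (twice M (k%:Z + 1))) else 0;
  W_chi2 : forall (M : nat) (i k : 'I_M), chi2 (W M i k) =
    if i == k then real_complex R (lambda (twice M k%:Z)) else 0;
  W_chi3 : forall (M : nat) (i k : 'I_M), chi3 (W M i k) =
    if i.+1 == k :> nat then real_complex R (q * cc M (twice M k%:Z)) else 0;
  W_free : forall (N : nat) (x : forall M : nat, 'M[R[i]]_M),
    \sum_(M < N) \sum_(p < M) \sum_(k < M) x M p k *: W M p k = 0 ->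
    forall M : nat, (M < N)%N -> x M = 0;
  W_span : forall a : G, exists (N : nat) (x : forall M : nat, 'M[R[i]]_M),
    a = \sum_(M < N) \sum_(p < M) \sum_(k < M) x M p k *: W M p k }.

(* The entry in row p and column j, read as 0 when j is not in {0,...,M-1}. *)
Definition entry0 (G : SUq2) (M : nat) (W : 'M[G]_M) (p : 'I_M) (j : int) : G :=
  \sum_(k < M | k%:Z == j) W p k.

(* The space E_1(M,p,k), for j = k + m. *)
Definition E1 (G : SUq2) (X : calculus G) (M : nat) (W : 'M[G]_M)
    (p : 'I_M) (j : int) (w : X) : Prop :=
  exists x y z : R[i],
    w = x *: (inA X (entry0 W p (j + 1)) * eta1 X)
      + y *: (inA X (entry0 W p j) * eta2 X)
      + z *: (inA X (entry0 W p (j - 1)) * eta3 X).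

Definition stable_under (V : Type) (T : V -> V) (E : V -> Prop) : Prop :=
  forall w, E w -> E (T w).

(* The inequality is that of R[i], for which x <= y means that                *)
(* y - x is real and nonnegative.                                             *)
Definition ge_on (V : lmodType R[i]) (ip : V -> V -> R[i]) (T : V -> V)
    (t : R) (E : V -> Prop) : Prop :=
  forall w, E w -> real_complex R t * ip w w <= ip (T w) w.

End QuantumGroup.

(* Main.v *)
Require Import Defs.
From HB Require Import structures.
From mathcomp Require Import all_boot all_order all_algebra.
From mathcomp Require Import reals complex.
From mathcomp Require Import ring lra zify.

Set Implicit Arguments.
Unset Strict Implicit.
Unset Printing Implicit Defensive.

Import Order.TTheory GRing.Theory Num.Theory.
Local Open Scope ring_scope.

(* Write d a = sum_r D_r(a) eta_r for a in A_q.  Moving eta_r past A_q is an  *)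
(* automorphism f_r, given by convolution with a character, which therefore   *)
(* preserves the Haar integral h.  Since h o D_r = 0, the twisted Leibniz     *)
(* rule D_r(ab) = D_r(a) f_r(b) + a D_r(b) and (d b)^* = d b^* show that, for *)
(* the inner product h(b^* a), D_1, D_2, D_3 have adjoints -q^-1 D_3, D_2 and *)
(* -q D_1.  This yields d^* in degrees 1 and 2, and also shows that the       *)
(* W_pk, for fixed p, all have the same norm.                                 *)
(* With a = c_(k+1), b = c_k, l = lambda_k, the form w = x W_(p,k+1) eta1 +   *)
(* y W_pk eta2 + z W_(p,k-1) eta3 satisfies                                   *)
(*   d^* w = A W_pk   and                                                     *)
(*   d w = - B W_(p,k+1) eta1 eta2 - q^4 D W_(p,k-1) eta2 eta3                *)
(*         + E W_pk eta3 eta1,                                                *)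
(* where A = -a x + l y + q b z, B = l x + a y, D = q b y - l z and           *)
(* E = q a x - q^-1 y + q^-2 b z.  Hence (nabla w | w) is, up to the norm of  *)
(* W_pk, A^2 + q^14 B^2 + q^12 E^2 + q^6 D^2.  If k <> 0, then                *)
(* l A + a B + q b D = (l^2 + a^2 + q^2 b^2) y bounds y, then x and z, by     *)
(* A, B, D divided by l, and l^2 >= q^4 max(q^(-8k), 1).  If k = 0, then      *)
(* l = 0, b^2 = q^2 a^2 and a^2 >= 1 (unless m = 0), and E is needed too.     *)

(** * Real inequalities *)

(** Both d and d^* square to zero, so (nabla w | w) = (d w | d w) + (d^* w | d^* w)
    ([ip_laplacian]), and the theorem asks for coercivity of this sum. On E_1(M,p,k) it becomes a
    quadratic form in x, y, z: [haar_adjoint] yields d^*, [dstar_weight] and [diff_weight] evaluate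
    d^* and d, and by [haar_entry0] the entries of a row share one norm, which factors out. The
    linear forms involved have real coefficients, so real and imaginary parts of x, y, z are bounded
    separately. If k is nonzero, lambda_k already has the required growth ([lambda_bound]), and
    [coercive_nondegenerate] applies. If k = 0, only a constant bound is required; c_0 and c_1
    supply it ([cc_weight0], [coercive_weight0]), except for M = 1, where only eta2 survives and d
    eta2 is nonzero. [spectral_bound] joins these cases, and [weighted_bound] handles indices
    outside {-m, ..., m}. *)

Lemma sqr_addr_le (F : realFieldType) (x y : F) :
  (x + y) ^+ 2 <= 2 * (x ^+ 2 + y ^+ 2).
Proof. have := sqr_ge0 (x - y); nra. Qed.

Lemma sqr_add3_le (F : realFieldType) (x y z : F) :
  (x + y + z) ^+ 2 <= 3 * (x ^+ 2 + y ^+ 2 + z ^+ 2).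
Proof.
have := sqr_ge0 (x - y); have := sqr_ge0 (x - z).
by have := sqr_ge0 (y - z); nra.
Qed.

(** Cauchy-Schwarz against (l, a, q b) bounds the squares of l y, a y and q b y by the sum S of the
    three squares. Then B and D bound the squares of l x and l z by 4 S each, and 4 + 1 + 4 = 9. *)
Lemma coercive_nondegenerate (F : realFieldType) (q a b l x y z : F) :
  l != 0 ->
  l ^+ 2 * (x ^+ 2 + y ^+ 2 + z ^+ 2) <=
  9 * ((- a * x + l * y + q * b * z) ^+ 2 + (l * x + a * y) ^+ 2
       + (q * b * y - l * z) ^+ 2).
Proof.
move=> l_neq0.
set A := - a * x + _ + _; set B := l * x + _; set D := _ - l * z.
set S := A ^+ 2 + B ^+ 2 + D ^+ 2.
have l2_gt0 : 0 < l ^+ 2 by rewrite exprn_even_gt0.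
(* This combination eliminates x and z. *)
have yE : (l ^+ 2 + a ^+ 2 + (q * b) ^+ 2) * y = l * A + a * B + q * b * D.
  by rewrite /A /B /D; ring.
have a2_ge0 := sqr_ge0 a; have b2_ge0 := sqr_ge0 (q * b).
have CS : (l * A + a * B + q * b * D) ^+ 2 <=
          (l ^+ 2 + a ^+ 2 + (q * b) ^+ 2) * S.
  (* Lagrange's identity: the defect in Cauchy-Schwarz is the sum of the squared 2 x 2 minors. *)
  have -> : (l ^+ 2 + a ^+ 2 + (q * b) ^+ 2) * S =
    (l * A + a * B + q * b * D) ^+ 2 + ((l * B - a * A) ^+ 2
     + (l * D - q * b * A) ^+ 2 + (a * D - q * b * B) ^+ 2).
    by rewrite /S; ring.
  by rewrite lerDl !addr_ge0 ?sqr_ge0.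
have yS : (l ^+ 2 + a ^+ 2 + (q * b) ^+ 2) * y ^+ 2 <= S.
  have s_gt0 : 0 < l ^+ 2 + a ^+ 2 + (q * b) ^+ 2 by lra.
  rewrite -(ler_pM2l s_gt0) mulrA -expr2 -exprMn.
  by rewrite yE.
have y2_ge0 := sqr_ge0 y.
have [ay by_] : (a * y) ^+ 2 <= S /\ (q * b * y) ^+ 2 <= S.
  rewrite ![(_ * y) ^+ 2]exprMn; move: yS; rewrite !mulrDl.
  have := mulr_ge0 (ltW l2_gt0) y2_ge0; have := mulr_ge0 a2_ge0 y2_ge0.
  by have := mulr_ge0 b2_ge0 y2_ge0; split; lra.
have ly : (l * y) ^+ 2 <= S.
  rewrite exprMn; move: yS; rewrite !mulrDl.
  have := mulr_ge0 a2_ge0 y2_ge0; by have := mulr_ge0 b2_ge0 y2_ge0; lra.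
have [BS DS] : B ^+ 2 <= S /\ D ^+ 2 <= S.
  rewrite /S; have := sqr_ge0 A; have := sqr_ge0 B.
  by have := sqr_ge0 D; split; lra.
have lx : (l * x) ^+ 2 <= 4 * S.
  have -> : l * x = B + - (a * y) by rewrite /B; ring.
  by apply: le_trans (sqr_addr_le _ _) _; rewrite sqrrN; lra.
have lz : (l * z) ^+ 2 <= 4 * S.
  have -> : l * z = q * b * y + - D by rewrite /D; ring.
  by apply: le_trans (sqr_addr_le _ _) _; rewrite sqrrN; lra.
have -> : l ^+ 2 * (x ^+ 2 + y ^+ 2 + z ^+ 2) =
          (l * x) ^+ 2 + (l * y) ^+ 2 + (l * z) ^+ 2 by ring.
by rewrite -/S; clearbody S; lra.
Qed.

(** Here a y controls y, the combination q^3 A + q^2 E + q y eliminates x and isolates b z, and A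
    then gives x. The squares of y, z, x are at most T, 3 T, 8 T, whence 12. *)
Lemma coercive_weight0 (F : realFieldType) (q a b x y z : F) :
  q != 0 -> q ^+ 2 <= 1 -> b ^+ 2 = q ^+ 2 * a ^+ 2 -> 1 <= a ^+ 2 ->
  x ^+ 2 + y ^+ 2 + z ^+ 2 <=
  12 * ((- a * x + q * b * z) ^+ 2 + (a * y) ^+ 2
       + (q * a * x - q^-1 * y + q ^- 2 * b * z) ^+ 2 + (q * b * y) ^+ 2).
Proof.
move=> q_neq0 q2_le1 b2E a2_ge1.
set A := - a * x + _; set E := q * a * x - _ + _.
have q2_gt0 : 0 < q ^+ 2 by rewrite exprn_even_gt0.
have y2_ge0 := sqr_ge0 y; have z2_ge0 := sqr_ge0 z.
have A2_ge0 := sqr_ge0 A; have E2_ge0 := sqr_ge0 E.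
rewrite [(a * y) ^+ 2]exprMn; set B := a ^+ 2 * y ^+ 2.
have yB : y ^+ 2 <= B by rewrite /B; nra.
have bE : (q ^+ 4 + 1) * (b * z) = q ^+ 3 * A + q ^+ 2 * E + q * y.
  by rewrite /A /E; field.
set T := A ^+ 2 + E ^+ 2 + B.
have T_ge0 : 0 <= T by rewrite /T; lra.
have bz_le : (b * z) ^+ 2 <= 3 * q ^+ 2 * T.
  apply: (@le_trans _ _ (((q ^+ 4 + 1) * (b * z)) ^+ 2)).
    rewrite [leRHS]exprMn ler_peMl ?sqr_ge0 //.
    by rewrite exprn_ege1 // lerDr exprn_even_ge0.
  rewrite bE; apply: le_trans (sqr_add3_le _ _ _) _.
  have -> : 3 * q ^+ 2 * T =
      3 * (q ^+ 2 * A ^+ 2 + q ^+ 2 * E ^+ 2 + q ^+ 2 * B).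
    by rewrite /T; ring.
  rewrite ler_pM2l ?ltr0n //.
  apply: lerD; last by rewrite exprMn ler_pM2l.
  apply: lerD; rewrite exprMn ler_wpM2r // -exprM.
    by rewrite (exprM q 2 3); apply: ler_iXnr (ltW q2_gt0) q2_le1.
  by rewrite (exprM q 2 2); apply: ler_iXnr (ltW q2_gt0) q2_le1.
have z_le : z ^+ 2 <= 3 * T.
  (* The factor q^2 kept in [bz_le] cancels against b^2 = q^2 a^2. *)
  have zT : a ^+ 2 * z ^+ 2 <= 3 * T.
    rewrite -(ler_pM2l q2_gt0) mulrA -b2E -exprMn.
    by apply: le_trans bz_le _; rewrite [leRHS]mulrCA [leRHS]mulrA.
  by apply: le_trans zT; rewrite ler_peMl.
have x_le : x ^+ 2 <= 8 * T.
  apply: (@le_trans _ _ ((a * x) ^+ 2)).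
    by rewrite exprMn ler_peMl ?sqr_ge0.
  have -> : a * x = q * (b * z) + - A by rewrite /A; ring.
  apply: le_trans (sqr_addr_le _ _) _; rewrite sqrrN exprMn.
  have qbz : q ^+ 2 * (b * z) ^+ 2 <= 3 * T.
    apply: le_trans (ler_wpM2r (sqr_ge0 _) q2_le1) _; rewrite mul1r.
    apply: le_trans bz_le _; rewrite -[leLHS]mulrA ler_pM2l ?ltr0n //.
    by rewrite ler_piMl.
  have : A ^+ 2 <= T by rewrite /T; lra.
  by lra.
have := sqr_ge0 (q * b * y); rewrite /T in z_le x_le *; lra.
Qed.

(** * The numbers c_k and lambda_k, and the quadratic form built from them *)

Section Weights.
Variables (R : realType) (q : R).
Hypotheses (q_neq0 : q != 0) (q2_lt1 : q ^+ 2 < 1).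

Lemma q2_gt0 : 0 < q ^+ 2.
Proof. by rewrite exprn_even_gt0. Qed.

(** As q may be negative, powers are compared through the base q^2, which lies in (0, 1). *)
Lemma exprz2M (n : int) : q ^ (2 * n) = (q ^+ 2) ^ n.
Proof. by rewrite exprnP exprz_exp. Qed.

Lemma exprz2_gt0 (n : int) : 0 < q ^ (2 * n).
Proof. by rewrite exprz2M exprz_gt0 ?q2_gt0. Qed.

Lemma exprz2_le (n : int) : 0 < n -> q ^ (2 * n) <= q ^+ 2.
Proof.
case: n => [[|n]|n] // _; rewrite exprz2M.
by apply: ler_iXnr => //; rewrite ltW // q2_gt0.
Qed.

Lemma exprz2V (n : int) : q ^ (- 2 * n) = (q ^ (2 * n))^-1.
Proof. by rewrite mulNr invr_expz. Qed.

(** In terms of the position i = k + m the two factors show the zeros i = 0 and i = M, that is k =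
    -m and k = m + 1. *)
Lemma cc_twice (M : nat) (i : int) : cc q M (twice M i) =
  q / (1 - q ^+ 2)
  * Num.sqrt (((q ^ (2 * i))^-1 - 1) * (1 - q ^ (2 * (M%:Z - i)))).
Proof.
rewrite /cc /twice; congr (_ * Num.sqrt _).
set m := M%:Z - 1.
have -> : q ^ (- (2 * i - m)) = q ^ m / q ^ (2 * i).
  by rewrite invr_expz -expfzDr //; congr (q ^ _); ring.
have -> : q ^ (- (2 * i - m - 2)) = (q ^ m)^-1 * q ^ (2 * (M%:Z - i)).
  by rewrite invr_expz -expfzDr //; congr (q ^ _); rewrite /m; ring.
rewrite -[q ^ (- m)]invr_expz.
have : q ^ m != 0 by rewrite expfz_neq0.
have : q ^ (2 * i) != 0 by rewrite expfz_neq0.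
by move=> u0 w0; field; apply/andP; split.
Qed.

Lemma cc_bottom (M : nat) : cc q M (twice M 0) = 0.
Proof. by rewrite cc_twice mulr0 expr0z invr1 subrr mul0r sqrtr0 mulr0. Qed.

Lemma cc_top (M : nat) : cc q M (twice M M) = 0.
Proof. by rewrite cc_twice subrr mulr0 expr0z subrr mulr0 sqrtr0 mulr0. Qed.

(** Strictly between the two zeros the radicand is nonnegative, so [Num.sqrt] does not fall back on
    its default value 0. *)
Lemma sqr_cc_twice (M : nat) (i : int) : 0 < i < M%:Z ->
  cc q M (twice M i) ^+ 2 =
  q ^+ 2 / (1 - q ^+ 2) ^+ 2
  * (((q ^ (2 * i))^-1 - 1) * (1 - q ^ (2 * (M%:Z - i)))).
Proof.
move=> /andP[i_gt0 iM]; rewrite cc_twice exprMn expr_div_n sqr_sqrtr //.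
apply: mulr_ge0.
  rewrite subr_ge0 invf_ge1 ?exprz2_gt0 //.
  exact: le_trans (exprz2_le i_gt0) (ltW q2_lt1).
rewrite subr_ge0; apply: le_trans (ltW q2_lt1).
by apply: exprz2_le; rewrite subr_gt0.
Qed.

Lemma cc_neq0 (M : nat) (i : int) : 0 < i < M%:Z -> cc q M (twice M i) != 0.
Proof.
move=> iM; rewrite -sqrf_eq0 sqr_cc_twice //; move: iM => /andP[i_gt0 iM].
have i'_gt0 : 0 < M%:Z - i by rewrite subr_gt0.
have u := exprz2_le i_gt0; have w := exprz2_le i'_gt0.
apply: mulf_neq0; apply: mulf_neq0; rewrite ?invr_eq0 ?expf_neq0 //.
- by rewrite gt_eqF // subr_gt0.
- by rewrite subr_eq0 invr_eq1 lt_eqF // (le_lt_trans u).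
- by rewrite subr_eq0 gt_eqF // (le_lt_trans w).
Qed.

(** At k = 0 one has M = 2 j + 1. With s = q^(2j) and p = q^2, c_1^2 = (1 - s)(1 - s p) / (s (1 -
    p)^2), and c_0^2 is p times that; the bound by 1 follows from s <= p < 1. *)
Lemma cc_weight0 (M : nat) (j : int) : twice M j = 0 -> 0 < j ->
  cc q M (twice M j) ^+ 2 = q ^+ 2 * cc q M (twice M (j + 1)) ^+ 2 /\
  1 <= cc q M (twice M (j + 1)) ^+ 2.
Proof.
move=> /eqP; rewrite subr_eq0 => /eqP E j_gt0.
have ME : M%:Z = 2 * j + 1 by rewrite E subrK.
have j1M : 0 < j + 1 < M%:Z by rewrite ME; apply/andP; split; lia.
have jM : 0 < j < M%:Z by rewrite ME; apply/andP; split; lia.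
rewrite !sqr_cc_twice //.
have -> : M%:Z - j = j + 1 by rewrite ME; ring.
have -> : M%:Z - (j + 1) = j by rewrite ME; ring.
have -> : q ^ (2 * (j + 1)) = q ^ (2 * j) * q ^+ 2.
  by rewrite mulrDr mulr1 expfzDr.
have := exprz2_le j_gt0; have := exprz2_gt0 j; have := q2_gt0; move: q2_lt1.
move: (q ^ (2 * j)) (q ^+ 2) => s p p_lt1 p_gt0 s_gt0 sp.
split; first by field; rewrite !gt_eqF //; lra.
rewrite -(ler_pM2r (_ : 0 < s * (1 - p) ^+ 2)); last first.
  by rewrite mulr_gt0 // exprn_gt0 // subr_gt0.
have -> : p / (1 - p) ^+ 2 * (((s * p)^-1 - 1) * (1 - s)) * (s * (1 - p) ^+ 2)
  = (1 - s * p) * (1 - s) by field; rewrite !gt_eqF //; lra.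
rewrite mul1r; apply: (@le_trans _ _ ((1 - p) * (1 - p))).
  by rewrite expr2 ler_piMl // ?mulr_ge0 //; lra.
by apply: ler_pM; nra.
Qed.

(** As K is a nonzero integer, u = q^(-2K) is either at least q^-2, which gives lambda >= q^2 u, or
    at most q^2, which gives lambda <= - q^2. *)
Lemma lambda_bound (K : int) : K != 0 -> lambda q K != 0 /\
  q ^+ 4 * Num.max (q ^ (- 4 * K)) 1 <= lambda q K ^+ 2.
Proof.
move=> K_neq0.
have p_gt0 := q2_gt0.
have E4 : q ^ (- 4 * K) = (q ^ (- 2 * K)) ^+ 2.
  by rewrite exprnP exprz_exp; congr (q ^ _); ring.
have eqE : lambda q K * (1 - q ^+ 2) = q ^+ 2 * (q ^ (- 2 * K) - 1).
  by rewrite /lambda -exprnP; field; rewrite gt_eqF // subr_gt0.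
have q4 : q ^+ 4 = q ^+ 2 * q ^+ 2 by rewrite -exprD.
rewrite E4 q4.
have [K_gt0|K_lt0|K0] := ltgtP 0 K; last by rewrite -K0 eqxx in K_neq0.
- have u_ge : 1 <= q ^+ 2 * q ^ (- 2 * K).
    by rewrite exprz2V ler_pdivlMr ?exprz2_gt0 // mul1r exprz2_le.
  have le_lambda : q ^+ 2 * q ^ (- 2 * K) <= lambda q K.
    by rewrite -(ler_pM2r (_ : 0 < 1 - q ^+ 2)) ?subr_gt0 // eqE; nra.
  have l_ge1 := le_trans u_ge le_lambda.
  split; first by rewrite gt_eqF // (lt_le_trans ltr01).
  have u_ge1 : 1 <= q ^ (- 2 * K).
    apply: le_trans u_ge _.
    by rewrite ler_piMl ?ltW // exprz2V invr_gt0 exprz2_gt0.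
  rewrite (max_idPl _); last exact: exprn_ege1.
  by rewrite -expr2 -exprMn lerXn2r // nnegrE; lra.
- have u_le : q ^ (- 2 * K) <= q ^+ 2.
    by rewrite -mulrN1 -mulrA mulN1r mulrN -mulrN exprz2_le // oppr_gt0.
  have u_gt0 : 0 < q ^ (- 2 * K) by rewrite exprz2V invr_gt0 exprz2_gt0.
  have lambda_le : lambda q K <= - q ^+ 2.
    by rewrite -(ler_pM2r (_ : 0 < 1 - q ^+ 2)) ?subr_gt0 // eqE; nra.
  split; first by rewrite lt_eqF //; lra.
  rewrite (max_idPr _); last first.
    by apply: exprn_ile1; [exact: ltW | exact: le_trans u_le (ltW q2_lt1)].
  by rewrite mulr1 -expr2 -[leRHS]sqrrN lerXn2r // ?nnegrE; lra.
Qed.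

(** The increment q^2 + q^4 is the coefficient in d eta1 and d eta3, so these terms are absorbed
    into lambda_k when d is computed on E_1. *)
Lemma lambdaS (K : int) :
  q ^+ 4 * lambda q (K + 2) = lambda q K + q ^+ 2 + q ^+ 4.
Proof.
have qn4 : q ^ (- 2 * (K + 2)) = q ^ (- 2 * K) * (q ^+ 4)^-1.
  by rewrite mulrDr expfzDr // exprnN.
by rewrite /lambda qn4 -!exprnP; field; rewrite q_neq0 gt_eqF // subr_gt0.
Qed.

(** In the constant, q^14 is a lower bound for the four weights, q^4 comes from [lambda_bound], and
    12 from the coercivity estimates. The last alternative is M = 1, k = 0, where E = - q^-1 y
    suffices. *)
Lemma spectral_bound (a b l t x y z : R) :
  (l != 0 /\ q ^+ 4 * t <= l ^+ 2) \/
  (t = 1 /\ l = 0 /\ ((b ^+ 2 = q ^+ 2 * a ^+ 2 /\ 1 <= a ^+ 2) \/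
                      [/\ a = 0, b = 0, x = 0 & z = 0])) ->
  q ^+ 18 / 12 * t * (x ^+ 2 + y ^+ 2 + z ^+ 2) <=
  (- a * x + l * y + q * b * z) ^+ 2 + q ^+ 14 * (l * x + a * y) ^+ 2
  + q ^+ 12 * (q * a * x - q^-1 * y + q ^- 2 * b * z) ^+ 2
  + q ^+ 6 * (q * b * y - l * z) ^+ 2.
Proof.
set A := - a * x + _ + _; set B := l * x + _; set E := _ - _ + _.
set D := q * b * y - _; move=> cases.
have p_gt0 := q2_gt0.
have even_le m n : (n <= m)%N -> q ^+ (2 * m) <= q ^+ (2 * n).
  by move=> nm; rewrite !exprM ler_wiXn2l // ltW.
have ge14 : q ^+ 14 * (A ^+ 2 + B ^+ 2 + E ^+ 2 + D ^+ 2) <=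
    A ^+ 2 + q ^+ 14 * B ^+ 2 + q ^+ 12 * E ^+ 2 + q ^+ 6 * D ^+ 2.
  have := ler_wpM2r (sqr_ge0 A) (even_le 7%N 0%N isT).
  have := ler_wpM2r (sqr_ge0 E) (even_le 7%N 6%N isT).
  have := ler_wpM2r (sqr_ge0 D) (even_le 7%N 3%N isT).
  by rewrite /= !mulrDr !muln0 expr0 mul1r; clearbody A B E D; lra.
have q14 : 0 < q ^+ 14 by rewrite (exprM q 2 7) exprn_gt0.
apply: le_trans ge14.
have -> : q ^+ 18 / 12 * t * (x ^+ 2 + y ^+ 2 + z ^+ 2) =
    q ^+ 14 * (q ^+ 4 * t * (x ^+ 2 + y ^+ 2 + z ^+ 2) / 12) by field.
rewrite ler_pM2l // ler_pdivrMr ?ltr0n //.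
set T := A ^+ 2 + B ^+ 2 + E ^+ 2 + D ^+ 2.
have n_ge0 : 0 <= x ^+ 2 + y ^+ 2 + z ^+ 2 by rewrite !addr_ge0 ?sqr_ge0.
have q4_le1 : q ^+ 4 <= 1 by exact: (even_le 2%N 0%N isT).
have q4_ge0 : 0 <= q ^+ 4 by rewrite (exprM q 2 2) exprn_ge0 // ltW.
case: cases => [[l_neq0 tl]|[t1 [l0 cases]]].
  apply: le_trans (ler_wpM2r n_ge0 tl) _.
  apply: le_trans (coercive_nondegenerate q a b x y z l_neq0) _.
  rewrite -/A -/B -/D /T; have := sqr_ge0 A; have := sqr_ge0 B.
  by have := sqr_ge0 D; have := sqr_ge0 E; clearbody A B E D; lra.
rewrite t1 mulr1; apply: (@le_trans _ _ (x ^+ 2 + y ^+ 2 + z ^+ 2)).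
  by rewrite ler_piMl.
case: cases => [[bE a_ge1]|[a0 b0 x0 z0]].
  apply: le_trans (coercive_weight0 x y z q_neq0 (ltW q2_lt1) bE a_ge1) _.
  rewrite mulrC ler_pM2r ?ltr0n // /T /A /B /D -/E l0 !mul0r addr0 add0r subr0.
  by [].
have yE : y ^+ 2 = q ^+ 2 * E ^+ 2.
  rewrite /E a0 b0 !mulr0 !mul0r add0r addr0 sqrrN -exprMn.
  by rewrite mulrA mulfV ?mul1r.
rewrite x0 z0 expr0n /= add0r addr0 yE.
have := ler_wpM2r (sqr_ge0 E) (ltW q2_lt1); rewrite mul1r /T.
have := sqr_ge0 A; have := sqr_ge0 B; have := sqr_ge0 D; have := sqr_ge0 E.
by clearbody A B E D; lra.
Qed.

(** The booleans tell whether k + 1, k and k - 1 are in range. The coefficient of a missing entry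
    can be replaced by 0, because a or b vanishes whenever it would couple a present entry with a
    missing one. *)
Lemma weighted_bound (d1 d2 d3 : bool) (a b l t N x y z : R) : 0 <= N ->
  (d2 != d1 -> a = 0) -> (d2 != d3 -> b = 0) ->
  (l != 0 /\ q ^+ 4 * t <= l ^+ 2) \/
  (t = 1 /\ l = 0 /\ ((b ^+ 2 = q ^+ 2 * a ^+ 2 /\ 1 <= a ^+ 2) \/
                      [/\ a = 0, b = 0, d1 = false & d3 = false])) ->
  let N_ (d : bool) := if d then N else 0 in
  q ^+ 18 / 12 * t * (x ^+ 2 * N_ d1 + y ^+ 2 * N_ d2 + z ^+ 2 * N_ d3) <=
  (- a * x + l * y + q * b * z) ^+ 2 * N_ d2
  + q ^+ 14 * (l * x + a * y) ^+ 2 * N_ d1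
  + q ^+ 12 * (q * a * x - q^-1 * y + q ^- 2 * b * z) ^+ 2 * N_ d2
  + q ^+ 6 * (q * b * y - l * z) ^+ 2 * N_ d3.
Proof.
move=> N_ge0 a0 b0 cases /=.
have cases' : l != 0 /\ q ^+ 4 * t <= l ^+ 2 \/
  t = 1 /\ l = 0 /\ (b ^+ 2 = q ^+ 2 * a ^+ 2 /\ 1 <= a ^+ 2 \/
    [/\ a = 0, b = 0, (if d1 then x else 0) = 0 & (if d3 then z else 0) = 0]).
  case: cases => [?|[? [? H]]]; first by left.
  right; split=> //; split=> //; case: H => [?|[? ? -> ->]]; first by left.
  by right; split.
have := ler_wpM2l N_ge0 (spectral_bound (if d2 then y else 0) cases').
clear cases cases'; move: a0 b0; case: d1; case: d2; case: d3 => /= a0 b0;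
  rewrite ?(a0 isT) ?(b0 isT); lra.
Qed.

End Weights.
(** * The Laplacian of the calculus *)

Section Laplacian.
Variables (R : realType) (q : R).
Local Notation Q := (qpow q).

(** * Star-algebra arithmetic and powers of q *)

Lemma starD (A : starAlg R) : {morph @star R A : a b / a + b}.
Proof. exact: is_starD (starP A). Qed.

Lemma starZ (A : starAlg R) c (a : A) : star (c *: a) = c^* *: star a.
Proof. exact: is_starZ (starP A) _ _. Qed.

Lemma starM (A : starAlg R) (a b : A) : star (a * b) = star b * star a.
Proof. exact: is_starM (starP A) _ _. Qed.

Lemma starK (A : starAlg R) : involutive (@star R A).
Proof. exact: is_starK (starP A). Qed.

Lemma star1 (A : starAlg R) : star 1 = 1 :> A.
Proof.
by have := starM 1 (star (1 : A)); rewrite mul1r starK mul1r => /esym.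
Qed.

Lemma star0 (A : starAlg R) : star 0 = 0 :> A.
Proof. by rewrite -[X in star X](scale0r (0 : A)) starZ conjC0 scale0r. Qed.

Lemma starN (A : starAlg R) (a : A) : star (- a) = - star a.
Proof. by rewrite -scaleN1r starZ rmorphN1 scaleN1r. Qed.

Lemma qpow_conj n : (Q n)^* = Q n.
Proof. by apply/CrealP; rewrite /qpow; apply/complex_realP; exists (q ^ n). Qed.

Hypothesis q_neq0 : q != 0.

Lemma qpowD m n : Q (m + n) = Q m * Q n.
Proof. by rewrite /qpow expfzDr // rmorphM. Qed.

Lemma qpow0 : Q 0 = 1.
Proof. by rewrite /qpow expr0z rmorph1. Qed.

Lemma qpowK n : Q n * Q (- n) = 1.
Proof. by rewrite -qpowD subrr qpow0. Qed.

Lemma qpow_neq0 n : Q n != 0.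
Proof.
apply/eqP => Qn0; move/eqP: (qpowK n).
by rewrite Qn0 mul0r eq_sym oner_eq0.
Qed.

Variable G : SUq2 q.

(** * Slices, convolution and invariance of the Haar integral *)

Lemma bilin_slice_r (f : {scalar G}) : bilin (fun a b : G => f b *: a).
Proof.
split=> [a|b] c x y; first by rewrite linearP scalerDl scalerA.
by rewrite scalerDr !scalerA mulrC.
Qed.

Lemma bilin_slice_l (f : {scalar G}) : bilin (fun a b : G => f a *: b).
Proof.
split=> [a|b] c x y; first by rewrite scalerDr !scalerA mulrC.
by rewrite linearP scalerDl scalerA.
Qed.

Lemma slice_r_ten (f : {scalar G}) a b : slice_r f (ten (AqT G) a b) = f b *: a.
Proof. exact: tlift_ten (bilin_slice_r f) _ _. Qed.

Lemma slice_l_ten (f : {scalar G}) a b : slice_l f (ten (AqT G) a b) = f a *: b.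
Proof. exact: tlift_ten (bilin_slice_l f) _ _. Qed.

Fact slice_r_linear (f : {scalar G}) : linear (slice_r (T := AqT G) f).
Proof. exact: tlift_linear (bilin_slice_r f). Qed.

Fact slice_l_linear (f : {scalar G}) : linear (slice_l (T := AqT G) f).
Proof. exact: tlift_linear (bilin_slice_l f). Qed.

HB.instance Definition _ f :=
  GRing.isLinear.Build R[i] (AqT G) G _ _ (slice_r_linear f).
HB.instance Definition _ f :=
  GRing.isLinear.Build R[i] (AqT G) G _ _ (slice_l_linear f).

Fact conv_linear (f : {scalar G}) : linear (conv f).
Proof. by move=> c a b; rewrite /conv !linearP. Qed.

HB.instance Definition _ f :=
  GRing.isLinear.Build R[i] G G _ _ (conv_linear f).

(** The slices by h and f act on different legs of Delta(a) and commute; invariance turns the slice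
    by h into h(a) 1. *)
Lemma haar_conv (f : {scalar G}) a : haar G (conv f a) = f 1 * haar G a.
Proof.
suff slice_swap t : haar G (slice_r f t) = f (slice_l (T := AqT G) (haar G) t).
  by rewrite slice_swap haar_inv_l linearZ /= mulrC.
have [n [b [c ->]]] := ten_span t.
rewrite !linear_sum; apply: eq_bigr => i _.

by rewrite /= slice_r_ten slice_l_ten !linearZ /= mulrC.
Qed.

Lemma slice_rM (f : {scalar G}) : {morph f : a b / a * b} ->
  {morph slice_r (T := AqT G) f : s t / s * t}.
Proof.
move=> fM s t.
have [n [a1 [a2 ->]]] := ten_span s; have [m [b1 [b2 ->]]] := ten_span t.
rewrite mulr_suml !linear_sum mulr_suml; apply: eq_bigr => i _.
rewrite mulr_sumr !linear_sum mulr_sumr; apply: eq_bigr => j _.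
rewrite /= tenM !slice_r_ten fM.
by rewrite -scalerAl -scalerAr scalerA.
Qed.

Lemma convM (f : {scalar G}) : {morph f : a b / a * b} ->
  {morph conv f : a b / a * b}.
Proof. by move=> fM a b; rewrite /conv rmorphM slice_rM. Qed.

(** * Characters of A_q and the commutation of eta_r with coefficients *)

Lemma Delta_star_alpha : Delta G (star (alpha G)) =
  ten (AqT G) (star (alpha G)) (star (alpha G))
  - Q 1 *: ten (AqT G) (gamma G) (star (gamma G)).
Proof.
by rewrite Delta_star Delta_alpha starD starN starZ !ten_star starK qpow_conj.
Qed.

Lemma Delta_star_gamma : Delta G (star (gamma G)) =
  ten (AqT G) (star (gamma G)) (star (alpha G))
  + ten (AqT G) (alpha G) (star (gamma G)).
Proof. by rewrite Delta_star Delta_gamma starD !ten_star starK. Qed.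


(* Unlike C itself, C x C with this flip involution carries the characters    *)
(* alpha |-> t, alpha^* |-> 1/t for real t, which are not *-preserving.       *)
Definition flip_star (u : R[i]^o * R[i]^o) : R[i]^o * R[i]^o :=
  ((u.2 : R[i])^*, (u.1 : R[i])^*).

Fact flip_starP : @is_star R (R[i]^o * R[i]^o)%type flip_star.
Proof.
split=> [a b|c a|a b|[a1 a2]]; rewrite /flip_star /=.
- by rewrite !rmorphD.
- by congr pair; exact: rmorphM.
- by congr pair; rewrite /= rmorphM /= mulrC.
- by rewrite !conjCK.
Qed.

Definition flip_alg := StarAlg flip_starP.

(** The pair (q^n, q^-n) for alpha and 0 for gamma satisfy the relations in [flip_alg]; the first
    coordinate of the induced homomorphism is the character. *)
Lemma modular_character (n : int) : exists f : {scalar G},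
  [/\ {morph f : a b / a * b}, f 1 = 1,
      f (alpha G) = Q n /\ f (star (alpha G)) = Q (- n) &
      f (gamma G) = 0 /\ f (star (gamma G)) = 0].
Proof.
have rel : @SUq2_relations R q flip_alg (Q n, Q (- n)) 0.
  split; rewrite ?star0 ?mulr0 ?mul0r ?scaler0 ?addr0 //.
    by congr pair; rewrite /= qpow_conj ?qpowK // mulrC qpowK.
  by congr pair; rewrite /= qpow_conj ?qpowK // mulrC qpowK.
have [g [gstar galpha ggamma]] := @Aq_univ _ _ G _ _ _ rel.
have fst_linear : scalar (fun a => (g a).1 : R[i]).
  by move=> c a b; rewrite linearP.
pose f : {scalar G} := HB.pack (fun a => (g a).1 : R[i])
  (GRing.isLinear.Build R[i] G R[i] _ _ fst_linear).
exists f; split; rewrite /f /=.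
- by move=> a b; rewrite rmorphM.
- by rewrite rmorph1.
- by rewrite gstar galpha /= qpow_conj.
- by rewrite gstar ggamma star0.
Qed.

Definition modular (n : int) (f : {scalar G}) : Prop :=
  [/\ {morph f : a b / a * b}, f 1 = 1,
      f (alpha G) = Q n /\ f (star (alpha G)) = Q (- n) &
      f (gamma G) = 0 /\ f (star (gamma G)) = 0].

Lemma conv1 (f : {scalar G}) : conv f 1 = f 1 *: 1.
Proof. by rewrite /conv rmorph1 -(ten1 (AqT G)) slice_r_ten. Qed.

Lemma conv_modular n f : modular n f ->
  [/\ conv f (alpha G) = Q n *: alpha G,
      conv f (gamma G) = Q n *: gamma G,
      conv f (star (alpha G)) = Q (- n) *: star (alpha G) &
      conv f (star (gamma G)) = Q (- n) *: star (gamma G)].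
Proof.
move=> [_ _ [fa fa'] [fc fc']]; rewrite /conv.
rewrite Delta_alpha Delta_gamma Delta_star_alpha Delta_star_gamma.
rewrite !linearB !linearD !linearZ /= !slice_r_ten fa fa' fc fc'.
by rewrite !scale0r oppr0 !scaler0 !addr0.
Qed.

Variable X : calculus G.
Local Notation J := (inA X).
Local Notation e1 := (eta1 X).
Local Notation e2 := (eta2 X).
Local Notation e3 := (eta3 X).

Lemma eta_modular e n f : eta_commutes (inA X) e n -> modular (- n) f ->
  forall a, e * J a = J (conv f a) * e.
Proof.
move=> [eA eC eA' eC'] fP; have [fM f1 _ _] := fP.
have [fA fC fA' fC'] := conv_modular fP; rewrite opprK in fA' fC'.
pose P a := e * J a = J (conv f a) * e.
(* Generation uses closure under [star], which f need not respect, so the claim is carried for a and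
   [star a] together. *)
suff gen a : P a /\ P (star a) by move=> a; have [] := gen a.
elim/Aq_gen: a; rewrite /P.
- by rewrite star1 conv1 f1 scale1r rmorph1 mulr1 mul1r.
- by rewrite eA eA' fA fA' !linearZ /= !scalerAl.
- by rewrite eC eC' fC fC' !linearZ /= !scalerAl.
- move=> a b [Pa Pa'] [Pb Pb'].
  by rewrite starD !linearD /= !mulrDr !mulrDl Pa Pa' Pb Pb'.
- move=> c a [Pa Pa'].
  by rewrite starZ !linearZ /= -!scalerAr -!scalerAl Pa Pa'.
- move=> a b [Pa Pa'] [Pb Pb']; rewrite starM !(convM fM) !rmorphM /=.
  by rewrite !mulrA Pa Pb' -!mulrA Pb Pa'.
- by move=> a [Pa Pa']; rewrite starK.
Qed.

(** * Homogeneous forms and uniqueness of coefficients *)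

Lemma homogeneous_term (i : 'I_8) (a : G) :
  homogeneous J e1 e2 e3 (inv_deg i) (J a * inv_basis e1 e2 e3 i).
Proof.
exists [ffun l => if l == i then a else 0].
rewrite (bigD1 i) //= ffunE eqxx big1 ?addr0 // => l /andP[_ /negbTE li].
by rewrite ffunE li rmorph0 mul0r.
Qed.

Lemma homogeneous0 (a : G) : homogeneous J e1 e2 e3 0 (J a).
Proof. by rewrite -[J a]mulr1; exact: (homogeneous_term ord0 a). Qed.

Lemma homogeneous_eta : [/\ homogeneous J e1 e2 e3 1 e1,
  homogeneous J e1 e2 e3 1 e2 & homogeneous J e1 e2 e3 1 e3].
Proof.
have := homogeneous_term (@Ordinal 8 1 isT) 1.
have := homogeneous_term (@Ordinal 8 2 isT) 1.
have := homogeneous_term (@Ordinal 8 3 isT) 1.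
by rewrite rmorph1 !mul1r.
Qed.

Lemma basis_inj (a b : 'I_8 -> G) :
  \sum_i J (a i) * inv_basis e1 e2 e3 i =
  \sum_i J (b i) * inv_basis e1 e2 e3 i ->
  a =1 b.
Proof.
move=> ab i; have [c [_ c_uniq]] :=
  Omega_free (\sum_i J (a i) * inv_basis e1 e2 e3 i).
have ca : c = [ffun i => a i].
  by apply: c_uniq; apply: eq_bigr => k _; rewrite ffunE.
have cb : c = [ffun i => b i].
  by apply: c_uniq; rewrite ab; apply: eq_bigr => k _; rewrite ffunE.
by rewrite -[a i](ffunE (fun i => a i)) -ca cb ffunE.
Qed.

Lemma one_form_inj (a1 a2 a3 b1 b2 b3 : G) :
  J a1 * e1 + J a2 * e2 + J a3 * e3 = J b1 * e1 + J b2 * e2 + J b3 * e3 ->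
  [/\ a1 = b1, a2 = b2 & a3 = b3].
Proof.
pose a (i : 'I_8) := [:: 0; a1; a2; a3]`_i.
pose b (i : 'I_8) := [:: 0; b1; b2; b3]`_i.
move=> ab; suff E : a =1 b.
  split; [exact: (E (@Ordinal 8 1 isT)) | exact: (E (@Ordinal 8 2 isT))
    | exact: (E (@Ordinal 8 3 isT))].
apply: basis_inj; rewrite !big_ord_recl !big_ord0 /a /b /inv_basis /= ?nth_nil.
by rewrite !rmorph0 !mul0r !addr0 !add0r !addrA.
Qed.

(** * The twisted derivations D_r and their adjoints for the Haar integral *)

Variables (chi1 chi2 chi3 : {scalar G}).
Hypothesis chiP : is_chi X chi1 chi2 chi3.
Local Notation D1 := (conv chi1).
Local Notation D2 := (conv chi2).
Local Notation D3 := (conv chi3).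
Variables (f1 f2 : {scalar G}).
Hypotheses (f1P : modular (- 1) f1) (f2P : modular (- 2) f2).

Lemma eta1J a : e1 * J a = J (conv f1 a) * e1.
Proof. exact: eta_modular (eta1A X) f1P a. Qed.

Lemma eta2J a : e2 * J a = J (conv f2 a) * e2.
Proof. exact: eta_modular (eta2A X) f2P a. Qed.

Lemma eta3J a : e3 * J a = J (conv f1 a) * e3.
Proof. exact: eta_modular (eta3A X) f1P a. Qed.

Lemma diffJM a w : diff X (J a * w) =
  (J (D1 a) * e1 + J (D2 a) * e2 + J (D3 a) * e3) * w + J a * diff X w.
Proof. by rewrite (diffM _ (homogeneous0 a)) chiP expr0 mul1r. Qed.

(** Compare coefficients in d(ab) = (da) b + a db after moving each eta_r to the right of b. *)
Lemma conv_chiM a b : [/\ D1 (a * b) = D1 a * conv f1 b + a * D1 b,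
  D2 (a * b) = D2 a * conv f2 b + a * D2 b &
  D3 (a * b) = D3 a * conv f1 b + a * D3 b].
Proof.
apply: one_form_inj; rewrite -chiP rmorphM diffJM chiP !mulrDl -!mulrA.
rewrite eta1J eta2J eta3J !rmorphD !rmorphM !mulrDl !mulrDr -!mulrA.
by rewrite -!addrA; congr +%R; rewrite [RHS]addrCA; congr +%R;
  rewrite [LHS]addrCA; congr +%R; exact: addrCA.
Qed.

(** From d 1 = 0 one gets chi_r(1) = 0, and h(D_r a) = chi_r(1) h(a). *)
Lemma haar_conv_chi a :
  [/\ haar G (D1 a) = 0, haar G (D2 a) = 0 & haar G (D3 a) = 0].
Proof.
have diff1 : diff X 1 = 0.
  have := diffJM 1 1; rewrite -chiP rmorph1 !mulr1 mul1r => E.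
  by apply: (addrI (diff X 1)); rewrite addr0.
have /one_form_inj[E1 E2 E3] : J (D1 1) * e1 + J (D2 1) * e2 + J (D3 1) * e3 =
    J 0 * e1 + J 0 * e2 + J 0 * e3.
  by rewrite -chiP rmorph1 diff1 rmorph0 !mul0r !addr0.
have chi1E (f : {scalar G}) : conv f 1 = 0 -> f 1 = 0.
  rewrite conv1 => /(congr1 (haar G)).
  by rewrite linearZ /= haar1 mulr1 linear0.
by rewrite !haar_conv !chi1E ?mul0r.
Qed.

Lemma haar_modular n f a : modular n f -> haar G (conv f a) = haar G a.
Proof. by move=> [_ f_1 _ _]; rewrite haar_conv f_1 mul1r. Qed.

(** The involution exchanges eta1 and eta3 up to scalars, hence D_1 and D_3; moving the form back to
    the right inserts the character. *)
Lemma conv_chi_star a : [/\ D1 (star a) = Q (- 1) *: conv f1 (star (D3 a)),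
  D2 (star a) = - conv f2 (star (D2 a)) &
  D3 (star a) = Q 1 *: conv f1 (star (D1 a))].
Proof.
have [h1 h2 h3] := homogeneous_eta.
apply: one_form_inj; rewrite -chiP -ostarA diff_star chiP !ostarD.
rewrite !(ostarM (homogeneous0 _) h1) !(ostarM (homogeneous0 _) h2).
rewrite !(ostarM (homogeneous0 _) h3) !mul0n !expr0 !mul1r !ostarA.
rewrite ostar_eta1 ostar_eta2 ostar_eta3 !rmorphN !linearZ /= mulNr.
rewrite -!scalerAl eta1J eta2J eta3J mulNr.
by rewrite addrC addrA addrAC addrC addrA; congr +%R.
Qed.

(** Integration by parts: h kills D_r(b^* a), and the twists in the Leibniz and star rules merge
    into one convolution by a character, which h does not see. *)
Lemma haar_adjoint a b :
  [/\ haar G (star b * D1 a) = - Q (- 1) * haar G (star (D3 b) * a),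
      haar G (star b * D2 a) = haar G (star (D2 b) * a) &
      haar G (star b * D3 a) = - Q 1 * haar G (star (D1 b) * a)].
Proof.
have [f1M _ _ _] := f1P; have [f2M _ _ _] := f2P.
have [hD1 hD2 hD3] := haar_conv_chi (star b * a).
have [M1 M2 M3] := conv_chiM (star b) a.
have [S1 S2 S3] := conv_chi_star b.
split; apply/eqP.
- move: hD1; rewrite M1 S1 linearD /= -scalerAl -(convM f1M) linearZ /=.
  by rewrite (haar_modular _ f1P) mulNr -addr_eq0 addrC => ->.
- move: hD2; rewrite M2 S2 linearD /= mulNr -(convM f2M) linearN /=.
  by rewrite (haar_modular _ f2P) -subr_eq0 addrC => ->.
- move: hD3; rewrite M3 S3 linearD /= -scalerAl -(convM f1M) linearZ /=.
  by rewrite (haar_modular _ f1P) mulNr -addr_eq0 addrC => ->.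
Qed.

(** * The inner product in coordinates *)

Variable ip : X -> X -> R[i].
Hypotheses (ipP : inner_product ip) (ip_inv : left_invariant_ip ip)
  (ip_onb : orthonormal_onb ip).

Lemma ipDl x y z : ip (x + y) z = ip x z + ip y z.
Proof. by have := ip_linear ipP 1 x y z; rewrite scale1r mul1r. Qed.

Lemma ip0l z : ip 0 z = 0.
Proof. by apply: (addrI (ip 0 z)); rewrite -ipDl !addr0. Qed.

Lemma ipZl c x z : ip (c *: x) z = c * ip x z.
Proof. by rewrite -[c *: x]addr0 (ip_linear ipP) ip0l addr0. Qed.

Lemma ip_suml I r (P : pred I) (F : I -> X) z :
  ip (\sum_(i <- r | P i) F i) z = \sum_(i <- r | P i) ip (F i) z.
Proof. exact: (big_morph (ip^~ z) (fun x y => ipDl x y z) (ip0l z)). Qed.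

Lemma ip_sumr I r (P : pred I) (F : I -> X) z :
  ip z (\sum_(i <- r | P i) F i) = \sum_(i <- r | P i) ip z (F i).
Proof.
rewrite (ip_conj ipP) ip_suml rmorph_sum; apply: eq_bigr => i _.
by rewrite /= -(ip_conj ipP).
Qed.

Lemma ipDr x y z : ip z (x + y) = ip z x + ip z y.
Proof. by rewrite (ip_conj ipP) ipDl rmorphD /= -!(ip_conj ipP). Qed.

Lemma ipZr c x z : ip z (c *: x) = c^* * ip z x.
Proof. by rewrite (ip_conj ipP) ipZl rmorphM /= -(ip_conj ipP). Qed.

Lemma ip_nondegenerate x x' : (forall y, ip y x = ip y x') -> x = x'.
Proof.
move=> E; apply/eqP; rewrite -subr_eq0; apply/negPn/negP => /(ip_gt0 ipP).
by rewrite ipDr -scaleN1r ipZr rmorphN1 mulN1r E subrr ltxx.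
Qed.

(** Squared norms of the entries of [inv_basis]: the inverse squares of the scalings in [onb]. *)
Definition sqnorm (i : 'I_8) : R[i] :=
  [:: 1; 1; 1; 1; Q 14; Q (- 2); Q 12; 1]`_i.

Lemma ip_basis i k : ip (inv_basis e1 e2 e3 i) (inv_basis e1 e2 e3 k) =
  (i == k)%:R * sqnorm i.
Proof.
pose s (i : 'I_8) : R[i] := [:: 1; 1; 1; 1; Q (- 7); Q 1; - Q (- 6); 1]`_i.
have s_norm l : s l * (s l)^* * sqnorm l = 1.
  case: l => [[|[|[|[|[|[|[|[|//]]]]]]]] ?];
    rewrite /s /sqnorm /= ?rmorphN /= ?conjC1 ?mulrNN ?mulr1 ?mulr1 //;
    rewrite qpow_conj -!qpowD; exact: qpow0.
have s_neq0 l : s l != 0.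
  by apply/eqP => sl0; move/eqP: (s_norm l); rewrite sl0 !mul0r eq_sym oner_eq0.
have := ip_onb i k; rewrite /onb ipZl ipZr mulrA.
rewrite -/(s i) -/(s k); have [<- E | ne /eqP] := eqVneq i k; last first.
  rewrite mul0r mulf_eq0 mulf_eq0 conjC_eq0 !(negbTE (s_neq0 _)) /=.
  by move/eqP.
have u : s i * (s i)^* != 0 by rewrite mulf_eq0 conjC_eq0 !(negbTE (s_neq0 _)).
by rewrite mul1r; apply: (mulfI u); rewrite E s_norm.
Qed.

Lemma left_invariant_basis i : left_invariant_form (inv_basis e1 e2 e3 i).
Proof.
exists [ffun l => (l == i)%:R].
rewrite (bigD1 i) //= ffunE eqxx scale1r big1 ?addr0 // => l /negbTE li.
by rewrite ffunE li scale0r.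
Qed.

(** Short lists are padded by the default 0, so four entries starting with 0 give a 1-form, and
    seven entries starting with four zeros give a 2-form. *)
Definition form (s : seq G) : X := \sum_(i < 8) J s`_i * inv_basis e1 e2 e3 i.

Lemma ip_sum_basis (P P' : pred 'I_8) (a b : 'I_8 -> G) :
  ip (\sum_(i | P i) J (a i) * inv_basis e1 e2 e3 i)
     (\sum_(i | P' i) J (b i) * inv_basis e1 e2 e3 i) =
  \sum_(i | P i && P' i) sqnorm i * haar G (star (b i) * a i).
Proof.
rewrite ip_suml big_mkcondr; apply: eq_bigr => i _; rewrite ip_sumr.
have E k : ip (J (a i) * inv_basis e1 e2 e3 i)
    (J (b k) * inv_basis e1 e2 e3 k) =
    if k == i then sqnorm i * haar G (star (b i) * a i) else 0.
  rewrite ip_inv; try exact: left_invariant_basis.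
  rewrite ip_basis; have [<-|] := eqVneq i k; first by rewrite mul1r mulrC.
  by rewrite mul0r mulr0.
rewrite (eq_bigr _ (fun k _ => E k)) -big_mkcondr /=.
case: ifP => Pi; last first.
  by rewrite big1 // => k /andP[Pk /eqP ki]; rewrite ki Pi in Pk.
by rewrite (big_pred1 i) // => k; rewrite andb_idl // => /eqP ->.
Qed.

Lemma ip_form s t :
  ip (form s) (form t) = \sum_(i < 8) sqnorm i * haar G (star t`_i * s`_i).
Proof. exact: ip_sum_basis. Qed.

Lemma ip_homogeneous k l w w' : k != l -> homogeneous J e1 e2 e3 k w ->
  homogeneous J e1 e2 e3 l w' -> ip w w' = 0.
Proof.
move=> kl [a ->] [b ->]; rewrite ip_sum_basis big_pred0 // => i.
by apply/negP => /andP[/eqP ik /eqP il]; rewrite -ik -il eqxx in kl.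
Qed.

Lemma form0E a : form [:: a] = J a.
Proof.
rewrite /form !big_ord_recl big_ord0 /= ?nth_nil rmorph0.
by rewrite !mul0r !addr0 mulr1.
Qed.

Lemma form1E a b c : form [:: 0; a; b; c] = J a * e1 + J b * e2 + J c * e3.
Proof.
rewrite /form !big_ord_recl big_ord0 /= ?nth_nil rmorph0.
by rewrite !mul0r !addr0 add0r addrA.
Qed.

Lemma form2E a b c : form [:: 0; 0; 0; 0; a; b; c] =
  J a * (e1 * e2) + J b * (e2 * e3) + J c * (e3 * e1).
Proof.
rewrite /form !big_ord_recl big_ord0 /= ?nth_nil rmorph0.
by rewrite !mul0r !addr0 !add0r addrA.
Qed.

Lemma homogeneous_form1 a b c : homogeneous J e1 e2 e3 1 (form [:: 0; a; b; c]).
Proof.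
exists [ffun i : 'I_8 => [:: 0; a; b; c]`_i]; rewrite form1E.
rewrite big_mkcond /= !big_ord_recl big_ord0 !ffunE /=.
by rewrite !addr0 add0r addrA.
Qed.

Lemma homogeneous_form2 a b c :
  homogeneous J e1 e2 e3 2 (form [:: 0; 0; 0; 0; a; b; c]).
Proof.
exists [ffun i : 'I_8 => [:: 0; 0; 0; 0; a; b; c]`_i]; rewrite form2E.
rewrite big_mkcond /= !big_ord_recl big_ord0 !ffunE /=.
by rewrite !addr0 !add0r addrA.
Qed.

(** * The operators d and d^* on forms of low degree *)

Local Notation kappa := (Q 2 * (1 + Q 2)).

Lemma diff_J a : diff X (J a) = form [:: 0; D1 a; D2 a; D3 a].
Proof. by rewrite form1E chiP. Qed.

Lemma diff_Je1 a : diff X (J a * e1) =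
  form [:: 0; 0; 0; 0; - Q 4 *: D2 a + kappa *: a; 0; D3 a].
Proof.
rewrite form2E diffJM diff_eta1 rmorph0 mul0r addr0 linearD !linearZ /=.
rewrite !mulrDl -!mulrA eta11 mulr0 add0r eta21 -!scalerAr -!scalerAl.
by rewrite addrAC.
Qed.

Lemma diff_Je2 a : diff X (J a * e2) =
  form [:: 0; 0; 0; 0; D1 a; - Q 4 *: D3 a; - Q (- 1) *: a].
Proof.
rewrite form2E diffJM diff_eta2 eta13 !linearZ /=.
rewrite !mulrDl -!mulrA eta22 mulr0 addr0 eta32 -!scalerAr -!scalerAl scalerA.
by rewrite mulNr -qpowD.
Qed.

Lemma diff_Je3 a : diff X (J a * e3) =
  form [:: 0; 0; 0; 0; 0; D2 a + kappa *: a; - Q (- 2) *: D1 a].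
Proof.
rewrite form2E diffJM diff_eta3 rmorph0 mul0r add0r linearD !linearZ /=.
rewrite !mulrDl -!mulrA eta33 mulr0 addr0 eta13 -!scalerAr -!scalerAl.
by rewrite [RHS]addrC addrA.
Qed.

Lemma ip_form1 a b c a' b' c' :
  ip (form [:: 0; a; b; c]) (form [:: 0; a'; b'; c']) =
  haar G (star a' * a) + haar G (star b' * b) + haar G (star c' * c).
Proof.
rewrite ip_form !big_ord_recl big_ord0 /sqnorm /= ?nth_nil.
by rewrite !mulr0 !linear0 !mulr0 !addr0 !mul1r add0r addrA.
Qed.

Lemma ip_form2 a b c a' b' c' :
  ip (form [:: 0; 0; 0; 0; a; b; c]) (form [:: 0; 0; 0; 0; a'; b'; c']) =
  Q 14 * haar G (star a' * a) + Q (- 2) * haar G (star b' * b)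
  + Q 12 * haar G (star c' * c).
Proof.
rewrite ip_form !big_ord_recl big_ord0 /sqnorm /= ?nth_nil.
by rewrite !mulr0 !linear0 !mulr0 !addr0 !add0r addrA.
Qed.

Lemma ip_form0 a b : ip (J a) (J b) = haar G (star b * a).
Proof.
rewrite -!form0E ip_form !big_ord_recl big_ord0 /sqnorm /= ?nth_nil.
by rewrite !mulr0 !linear0 !mulr0 !addr0 mul1r.
Qed.

Variable dstar : {linear X -> X}.
Hypothesis dstarP : is_adjoint ip (diff X) dstar.

(** The inner product is nondegenerate and distinct degrees are orthogonal, so testing against basis
    forms of degree k is enough. *)
Lemma dstarE (w w' : X) k :
  homogeneous J e1 e2 e3 k.+1 w -> homogeneous J e1 e2 e3 k w' ->
  (forall (i : 'I_8) a, inv_deg i = k ->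
     ip (diff X (J a * inv_basis e1 e2 e3 i)) w =
     ip (J a * inv_basis e1 e2 e3 i) w') ->
  dstar w = w'.
Proof.
move=> wk wk' E; apply: ip_nondegenerate => y; rewrite -dstarP.
have [a [-> _]] := Omega_free y; rewrite linear_sum !ip_suml.
apply: eq_bigr => i _; have [ik|ik] := eqVneq (inv_deg i) k; first exact: E.
have hi := homogeneous_term i (a i).
by rewrite (ip_homogeneous _ (diff_deg hi) wk) ?(ip_homogeneous _ hi wk') ?eqSS.
Qed.

Lemma haarZ z a : haar G (z *: a) = z * haar G a.
Proof. exact: linearZ. Qed.

Lemma dstar_form1 a b c : dstar (form [:: 0; a; b; c]) =
  J (- Q (- 1) *: D3 a + D2 b - Q 1 *: D1 c).
Proof.
apply: dstarE (homogeneous_form1 _ _ _) (homogeneous0 _) _ => i y i0.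
have -> : i = ord0.
  by apply/val_inj; case: i i0 => [[|[|[|[|[|[|[|[|//]]]]]]]] ?].
rewrite mulr1 diff_J ip_form1 ip_form0.
have [-> _ _] := haar_adjoint y a; have [_ -> _] := haar_adjoint y b.
have [_ _ ->] := haar_adjoint y c.
rewrite !starD starN !starZ rmorphN /= !qpow_conj !mulrDl !mulNr -!scalerAl.
by rewrite !linearD linearN !haarZ mulNr.
Qed.

Lemma kappa_conj : kappa^* = kappa.
Proof. by rewrite rmorphM rmorphD rmorph1 /= qpow_conj. Qed.

(** The entries transpose [diff_Je1], [diff_Je2] and [diff_Je3] by means of [haar_adjoint], scaled
    by the squared norms q^14, q^-2, q^12. *)
Lemma dstar_form2 a b c : dstar (form [:: 0; 0; 0; 0; a; b; c]) =
  form [:: 0; Q 14 *: (- Q 4 *: D2 a + kappa *: a) - Q 13 *: D1 c;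
    - Q 13 *: D3 a + Q 3 *: D1 b - Q 11 *: c;
    Q (- 2) *: (D2 b + kappa *: b) + Q 9 *: D3 c].
Proof.
apply: dstarE (homogeneous_form2 _ _ _) (homogeneous_form1 _ _ _) _ => i y i1.
have [A1 A2 A3] := haar_adjoint y a; have [B1 B2 B3] := haar_adjoint y b.
have [C1 C2 C3] := haar_adjoint y c.
have E1 : J y * e1 = form [:: 0; y; 0; 0].
  by rewrite form1E !rmorph0 !mul0r !addr0.
have E2 : J y * e2 = form [:: 0; 0; y; 0].
  by rewrite form1E !rmorph0 !mul0r !addr0 add0r.
have E3 : J y * e3 = form [:: 0; 0; 0; y].
  by rewrite form1E !rmorph0 !mul0r !add0r.
have Qs : [/\ Q 13 = Q 12 * Q 1, Q 3 = Q (- 2) * Q 4 * Q 1,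
    Q 11 = Q 12 * Q (- 1), Q 9 = Q 12 * Q (- 2) * Q (- 1) & Q 13 = Q 14 * Q (- 1)].
  by split; rewrite -!qpowD.
have [Q13 Q3 Q11 Q9 Q13'] := Qs.
case: i i1 => [[|[|[|[|[|[|[|[|//]]]]]]]] ?] //= _; rewrite /inv_basis /=.
- rewrite diff_Je1 ip_form2 E1 ip_form1 !mulr0 linear0 mulr0 !addr0.
  rewrite !(starD, starN, starZ) kappa_conj rmorphN /= !qpow_conj.
  rewrite !mulrDl ?mulNr -!scalerAl ?mulrDl -?scalerAl ?mulrDr -!scalerAr.
  rewrite !linearD ?linearN ?haarZ ?linearD ?haarZ ?mulNr ?haarZ.
  rewrite A2 C3 Q13; ring.
- rewrite diff_Je2 ip_form2 E2 ip_form1 !mulr0 linear0 !addr0 add0r.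
  rewrite !(starD, starN, starZ) rmorphN /= !qpow_conj.
  rewrite !mulrDl ?mulNr -!scalerAl ?mulrDl -?scalerAl ?mulrDr -!scalerAr.
  rewrite !linearD ?linearN ?haarZ ?linearD ?haarZ ?mulNr ?haarZ.
  rewrite A1 B3 Q13' Q3 Q11; ring.
- rewrite diff_Je3 ip_form2 E3 ip_form1 !mulr0 linear0 mulr0 !add0r.
  rewrite !(starD, starN, starZ) kappa_conj !qpow_conj.
  rewrite !mulrDl ?mulNr -!scalerAl ?mulrDl -?scalerAl ?mulrDr -!scalerAr.
  rewrite !linearD ?linearN ?haarZ ?linearD ?haarZ ?mulNr ?haarZ.
  rewrite B2 C1 Q9; ring.
Qed.

(** * The Laplacian as d d^* + d^* d *)

Lemma dstar_dstar w : dstar (dstar w) = 0.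
Proof.
apply: ip_nondegenerate => y.
by rewrite -!dstarP diff_diff ip0l (ip_conj ipP) ip0l conjC0.
Qed.

Lemma laplacianE w :
  laplacian dstar w = diff X (dstar w) + dstar (diff X w).
Proof. by rewrite /laplacian !linearD /= diff_diff dstar_dstar addr0 add0r. Qed.

Lemma ip_laplacian w : ip (laplacian dstar w) w =
  ip (diff X w) (diff X w) + ip (dstar w) (dstar w).
Proof.
rewrite laplacianE ipDl dstarP addrC; congr (_ + _).
by rewrite (ip_conj ipP) -dstarP -(ip_conj ipP).
Qed.

(** * The derivations D_r on the matrix elements W_pk *)

Hypothesis q2_lt1 : q ^+ 2 < 1.
Variables (W : forall M : nat, 'M[G]_M).
Hypothesis WP : woronowicz_reps chi1 chi2 chi3 W.
Variables (M : nat) (p : 'I_M).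
Local Notation v := (entry0 (W M) p).
Local Notation c j := (cc q M (twice M j)).
Local Notation lam j := (lambda q (twice M j)).
Local Notation in_range j := (0 <= j < M%:Z).

Lemma entry0_ord (k : 'I_M) : v k = W M p k.
Proof. by rewrite /entry0 (big_pred1 k). Qed.

Lemma entry0_out j : ~~ in_range j -> v j = 0.
Proof.
move=> j_out; rewrite /entry0 big_pred0 // => k.
by apply/negP => /eqP E; rewrite -E ltz_nat ltn_ord in j_out.
Qed.

Lemma in_rangeP j : in_range j -> exists k : 'I_M, j = k%:Z.
Proof. by case: j => // n /andP[_ nM]; exists (Ordinal nM). Qed.

Lemma conv_W (f : {scalar G}) (k : 'I_M) :
  conv f (W M p k) = \sum_i f (W M i k) *: W M p i.
Proof.
rewrite /conv (W_Delta WP) linear_sum; apply: eq_bigr => i _.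
exact: slice_r_ten.
Qed.

Lemma D1_entry0 j : D1 (v j) = - real_complex R (c (j + 1)) *: v (j + 1).
Proof.
have [/in_rangeP[k ->]|jE] := boolP (in_range j).
  rewrite entry0_ord conv_W /entry0 scaler_sumr [RHS]big_mkcond.
  apply: eq_bigr => i _; rewrite (W_chi1 WP) -PoszD addn1 eqz_nat.
  by case: eqP => _; rewrite ?scale0r // rmorphN.
(* Only j = -1 is out of range with j + 1 in range, and there the coefficient c vanishes. *)
rewrite (entry0_out jE) linear0; have [->|j1] := eqVneq j (-1).
  by rewrite addNr cc_bottom // rmorph0 oppr0 scale0r.
rewrite entry0_out ?scaler0 //; apply/negP => /andP[j1_ge0 jM].
by move/negP: jE; apply; apply/andP; split; lia.
Qed.

Lemma D3_entry0 j : D3 (v j) = real_complex R (q * c j) *: v (j - 1).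
Proof.
have [/in_rangeP[k ->]|jE] := boolP (in_range j).
  rewrite entry0_ord conv_W /entry0 scaler_sumr [RHS]big_mkcond.
  apply: eq_bigr => i _; rewrite (W_chi3 WP) -(can2_eq (addrK _) (subrK _)).
  rewrite -PoszD addn1 eqz_nat.
  by case: eqP => _; rewrite ?scale0r.
(* Only j = M is out of range with j - 1 in range, and there the coefficient c vanishes. *)
rewrite (entry0_out jE) linear0; have [->|j1] := eqVneq j M%:Z.
  by rewrite cc_top // mulr0 rmorph0 scale0r.
rewrite entry0_out ?scaler0 //; apply/negP => /andP[j1_ge0 jM].
by move/negP: jE; apply; apply/andP; split; lia.
Qed.

Lemma D2_entry0 j : D2 (v j) = real_complex R (lam j) *: v j.
Proof.
have [/in_rangeP[k ->]|/entry0_out ->] := boolP (in_range j); last first.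
  by rewrite linear0 scaler0.
rewrite entry0_ord conv_W (bigD1 k) //= (W_chi2 WP) eqxx big1 ?addr0 // => i ik.
by rewrite (W_chi2 WP) (negbTE ik) scale0r.
Qed.

(** Pair W_(p,k+1) with D_1 W_pk and move D_1 across: both sides carry the same nonzero factor
    c_(k+1). *)
Lemma haar_entry0_step j : in_range j -> in_range (j + 1) ->
  haar G (star (v (j + 1)) * v (j + 1)) = haar G (star (v j) * v j).
Proof.
move=> jM j1M; have [H _ _] := haar_adjoint (v j) (v (j + 1)); move: H.
rewrite D1_entry0 D3_entry0 addrK starZ -!scalerAr -!scalerAl !haarZ.
have cE : c (j + 1) != 0 by apply: cc_neq0 => //; apply/andP; split; lia.
have -> : (real_complex R (q * c (j + 1)))^* = real_complex R (q * c (j + 1)).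
  by apply/CrealP/complex_realP; exists (q * c (j + 1)).
have QE : Q (- 1) * real_complex R (q * c (j + 1)) = real_complex R (c (j + 1)).
  by rewrite /qpow -rmorphM mulrA exprN1 mulVf ?mul1r.
rewrite [- Q _ * _]mulNr mulrA QE -mulNr.
by apply: mulfI; rewrite oppr_eq0 fmorph_eq0.
Qed.

Lemma haar_entry0 : exists2 N : R, 0 <= N & forall j,
  haar G (star (v j) * v j) = real_complex R (if in_range j then N else 0).
Proof.
have M_gt0 : (0 < M)%N by case: (M) p => // -[].
have := haar_ge0 (v 0); rewrite lecE => /andP[/eqP im_h re_h].
exists (complex.Re (haar G (star (v 0) * v 0))) => // j.
have [jM|/entry0_out ->] := boolP (in_range j); last first.
  by rewrite mulr0 linear0 rmorph0.
case: j jM => // n nM; rewrite ltz_nat /= in nM; elim: n nM => [|n IHn] nM.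
  by rewrite [LHS]complexE im_h mulr0 addr0.
rewrite -addn1 PoszD haar_entry0_step ?IHn //; first exact: ltnW.
  by rewrite ltz_nat ltnW.
by rewrite -PoszD addn1.
Qed.

Lemma convZ (f : {scalar G}) z a : conv f (z *: a) = z *: conv f a.
Proof. exact: linearZ. Qed.

Lemma form1D a b c a' b' c' : form [:: 0; a; b; c] + form [:: 0; a'; b'; c'] =
  form [:: 0; a + a'; b + b'; c + c'].
Proof.
rewrite !form1E !rmorphD !mulrDl [LHS]addrACA.
by congr +%R; exact: addrACA.
Qed.

Lemma form2D a b c a' b' c' :
  form [:: 0; 0; 0; 0; a; b; c] + form [:: 0; 0; 0; 0; a'; b'; c'] =
  form [:: 0; 0; 0; 0; a + a'; b + b'; c + c'].
Proof.
rewrite !form2E !rmorphD !mulrDl [LHS]addrACA.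
by congr +%R; exact: addrACA.
Qed.

Lemma E1_form (j : int) w : E1 (W M) p j w <-> exists x y z,
  w = form [:: 0; x *: v (j + 1); y *: v j; z *: v (j - 1)].
Proof.
split=> -[x [y [z ->]]]; exists x, y, z;
  by rewrite form1E !linearZ /= -!scalerAl.
Qed.

Local Notation r := (real_complex R).

Lemma Q_lambdaS j : Q 4 * r (lam (j + 1)) = r (lam j) + Q 2 + Q 4.
Proof.
have -> : twice M (j + 1) = twice M j + 2 by rewrite /twice; ring.
by rewrite /qpow -!rmorphD -rmorphM /= -!exprnP lambdaS.
Qed.

(** * The Laplacian on a single space E_1(M,p,k) *)

Section Weight.
Variables (j : int) (x y z : R[i]).
Let w := form [:: 0; x *: v (j + 1); y *: v j; z *: v (j - 1)].
Let L (s1 s2 s3 : R) : R[i] := r s1 * x + r s2 * y + r s3 * z.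

Lemma dstar_weight : dstar w = J (L (- c (j + 1)) (lam j) (q * c j) *: v j).
Proof.
rewrite dstar_form1; congr (J _).
rewrite !convZ D1_entry0 D2_entry0 D3_entry0 addrK subrK.
rewrite -!scaleNr !scalerA -!scalerDl; congr (_ *: _).
have Q1 : Q 1 = r q by [].
have QV : Q (- 1) = (r q)^-1 by rewrite /qpow exprN1 fmorphV.
have rq_neq0 : r q != 0 by rewrite fmorph_eq0.
rewrite /L; move: (c (j + 1)) (c j) (lam j) => a b l.
by rewrite !rmorphM !rmorphN /= Q1 QV; field.
Qed.

(** [Q_lambdaS] rewrites lambda_(k+1) and lambda_(k-1), together with the terms from d eta1 and d
    eta3, in terms of lambda_k alone. *)
Lemma diff_weight : diff X w = form [:: 0; 0; 0; 0;
  - L (lam j) (c (j + 1)) 0 *: v (j + 1);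
  - (Q 4 * L 0 (q * c j) (- lam j)) *: v (j - 1);
  L (q * c (j + 1)) (- q^-1) (q ^- 2 * c j) *: v j].
Proof.
rewrite /w form1E !linearD /= diff_Je1 diff_Je2 diff_Je3 !form2D !convZ.
rewrite !D1_entry0 !D2_entry0 !D3_entry0 addrK subrK add0r addr0.
have Q4 : Q 4 = Q 2 * Q 2 by rewrite -qpowD.
have S1 := Q_lambdaS j; have := Q_lambdaS (j - 1); rewrite subrK => S2.
have QV : Q (- 1) = r q^-1 by [].
have QV2 : Q (- 2) = r (q ^- 2) by rewrite /qpow -exprnN.
congr form; do 4!congr cons; congr [:: _; _; _]; rewrite !scalerA -!scalerDl;
  congr (_ *: _).
- rewrite /L rmorph0; move: (c (j + 1)) => a.
  have -> : r (lam (j + 1)) = (r (lam j) + Q 2 + Q 4) / Q 4.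
    by rewrite -S1 mulrAC mulfV ?qpow_neq0 ?mul1r.
  by rewrite Q4; field; rewrite fmorph_eq0.
- rewrite /L rmorph0 rmorphN; move: (q * c j) => b.
  have -> : r (lam (j - 1)) = Q 4 * r (lam j) - Q 2 - Q 4 by rewrite S2; ring.
  by rewrite Q4; ring.
- rewrite /L; move: (c (j + 1)) (c j) => a b.
  by rewrite !rmorphM !rmorphN /= QV QV2; ring.
Qed.

Lemma laplacian_weight : exists x' y' z', laplacian dstar w =
  form [:: 0; x' *: v (j + 1); y' *: v j; z' *: v (j - 1)].
Proof.
rewrite laplacianE dstar_weight diff_weight diff_J dstar_form2 form1D.
rewrite !convZ !D1_entry0 !D2_entry0 !D3_entry0 addrK subrK.
(* Only the shape matters: the witnesses are the collected scalars, read off by unification. *)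
do 3!eexists; congr form; congr cons; congr [:: _; _; _];
  rewrite ?scalerA -?scalerDl ?scalerA -?scaleNr -?scalerDl ?scalerA -?scalerDl;
  reflexivity.
Qed.

Local Notation sq u := (complex.Re u ^+ 2 + complex.Im u ^+ 2).

Lemma conj_mul_real (u : R[i]) : u^* * u = r (sq u).
Proof.
rewrite [u^*]/(conjc u); case: u => a b; apply/eqP; rewrite eq_complex /=.
by apply/andP; split; apply/eqP; ring.
Qed.

Lemma sq_lincomb s1 s2 s3 : sq (L s1 s2 s3) =
  (s1 * complex.Re x + s2 * complex.Re y + s3 * complex.Re z) ^+ 2
  + (s1 * complex.Im x + s2 * complex.Im y + s3 * complex.Im z) ^+ 2.
Proof.
by rewrite /L; case: x => ? ?; case: y => ? ?; case: z => ? ? /=; ring.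
Qed.

Lemma haar_sq (u : R[i]) a : haar G (star (u *: a) * (u *: a)) =
  r (sq u) * haar G (star a * a).
Proof.
by rewrite starZ -scalerAr -scalerAl !haarZ mulrA -conj_mul_real [u * _]mulrC.
Qed.

Lemma laplacian_weight_ge : -1 <= j <= M%:Z ->
  r (q ^+ 18 / 12 * Num.max (q ^ (- 4 * twice M j)) 1) * ip w w <=
  ip (laplacian dstar w) w.
Proof.
move=> j_range; rewrite ip_laplacian dstar_weight diff_weight /w.
rewrite ip_form1 ip_form2 ip_form0 !haar_sq.
have [N N_ge0 NE] := haar_entry0; rewrite !NE.
have sqM k u : sq (Q k * u) = (q ^ k) ^+ 2 * sq u.
  by case: u => a b; rewrite /qpow /=; ring.
have sqN (u : R[i]) : sq (- u) = sq u by case: u => a b /=; ring.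
rewrite !sqN sqM !sq_lincomb /qpow -!(rmorphM, rmorphD) /= lecR.
(* If exactly one of j, j + 1 is in range, then j + 1 is 0 or M, a zero of c. *)
have xor1 : in_range j != in_range (j + 1) -> c (j + 1) = 0.
  move=> H; have [->|->] : j + 1 = 0 \/ j + 1 = M%:Z by lia.
    exact: cc_bottom.
  exact: cc_top.
have xor2 : in_range j != in_range (j - 1) -> c j = 0.
  move=> H; have [->|->] : j = 0 \/ j = M%:Z by lia.
    exact: cc_bottom.
  exact: cc_top.
pose t := Num.max (q ^ (- 4 * twice M j)) 1.
have cases : (lam j != 0 /\ q ^+ 4 * t <= lam j ^+ 2) \/
  (t = 1 /\ lam j = 0 /\ ((c j ^+ 2 = q ^+ 2 * c (j + 1) ^+ 2 /\
     1 <= c (j + 1) ^+ 2) \/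
   [/\ c (j + 1) = 0, c j = 0, in_range (j + 1) = false
     & in_range (j - 1) = false])).
  have [K0|/lambda_bound H] := eqVneq (twice M j) 0; last by left; exact: H.
  right; split; first by rewrite /t K0 mulr0 expr0z maxxx.
  split; first by rewrite K0 /lambda mulr0 expr0z subrr mulr0.
  (* With k = 0, a position j > 0 means M >= 3; otherwise j = 0 and M = 1. *)
  have [j_gt0|j_le0] := ltP 0 j; first by left; exact: cc_weight0.
  have M_gt0 : (0 < M)%N by case: (M) p => // -[].
  have [j0 M1] : j = 0 /\ M%:Z = 1 by move: K0; rewrite /twice; lia.
  right; rewrite j0 add0r; split; [| | lia | lia].
    by rewrite -M1; exact: cc_top.
  exact: cc_bottom.
have B u1 u2 u3 := weighted_bound q_neq0 q2_lt1 u1 u2 u3 N_ge0 xor1 xor2 cases.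
(* By [sq_lincomb] the squared moduli split into real and imaginary parts, each bounded by [B]. *)
have := lerD (B (complex.Re x) (complex.Re y) (complex.Re z))
             (B (complex.Im x) (complex.Im y) (complex.Im z)).
rewrite -/t; move: (if in_range (j + 1) then N else 0) => N1.
move: (if in_range j then N else 0) => N2.
move: (if in_range (j - 1) then N else 0) => N3.
(* The squared norm q^-2 of eta2 eta3 meets the square of the factor q^4 in d w, leaving q^6. *)
have -> u n : q ^ (- 2) * ((q ^ 4) ^+ 2 * u * n) = q ^+ 6 * u * n.
  by rewrite -[q ^ (- 2)]/(q ^- 2) -[q ^ 4]exprnP; field.
rewrite -[q ^ 14]exprnP -[q ^ 12]exprnP => H; lra.
Qed.

End Weight.
End Laplacian.

Theorem theorem8p3 (R : realType) (q : R) (q_gt0 : 0 < `|q|) (q_lt1 : `|q| < 1) :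
  exists C : R, 0 < C /\
  forall (G : SUq2 q) (X : calculus G)
    (ip : X -> X -> R[i]) (ipP : inner_product ip)
    (ip_inv : left_invariant_ip ip) (ip_onb : orthonormal_onb ip)
    (dstar : {linear X -> X}) (dstarP : is_adjoint ip (diff X) dstar)
    (chi1 chi2 chi3 : {scalar G}) (chiP : is_chi X chi1 chi2 chi3)
    (W : forall M : nat, 'M[G]_M) (WP : woronowicz_reps chi1 chi2 chi3 W)
    (M : nat) (M_ge1 : (1 <= M)%N) (p : 'I_M)
    (j : int) (j_range : -1 <= j <= M%:Z),
    stable_under (laplacian dstar) (E1 (X := X) (W M) p j) /\
    ge_on ip (laplacian dstar) (C * Num.max (q ^ (- 4 * twice M j)) 1)
      (E1 (X := X) (W M) p j).
Proof.
have q_neq0 : q != 0 by rewrite -normr_gt0.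
have q2_lt1 : q ^+ 2 < 1 by rewrite -real_normK ?num_real // expr_lt1.
exists (q ^+ 18 / 12); split.
  by rewrite divr_gt0 ?ltr0n // exprn_even_gt0.
move=> G X ip ipP ip_inv ip_onb dstar dstarP chi1 chi2 chi3 chiP W WP.
move=> M _ p j jM.
(* [f1] implements the commutation of both eta1 and eta3 with A_q, [f2] that of eta2. *)
have [f1 f1P] := modular_character q_neq0 G (- 1).
have [f2 f2P] := modular_character q_neq0 G (- 2).
split=> w /E1_form[x [y [z ->]]]; last first.
  exact: (laplacian_weight_ge q_neq0 chiP f1P f2P ipP ip_inv ip_onb dstarP
            q2_lt1 WP p x y z jM).
apply/E1_form.
exact: (laplacian_weight q_neq0 chiP f1P f2P ipP ip_inv ip_onb dstarP
          q2_lt1 WP p j x y z).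
Qed.
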